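(* Let $f=h+\overline{g}\in \mathscr{U}^0_H(16.5)$ have the series representation $$f(z)=h(z)+\overline{g(z)}=z+\sum_{k=2}^{\infty}a_kz^k+\sum_{k=2}^{\infty}\overline{b_kz^k},\qquad z\in\mathbb{D}.$$ Then $$|a_n|<5.24\times 10^{-6}\,n^{17}\quad\text{and}\quad |b_n|<2.32\times 10^{-7}\,n^{17}\quad\text{for all integers } n\ge 3.$$
   Context: $\mathbb{D}=\{z\in\mathbb{C}:|z|<1\}$. A harmonic mapping $f$ of $\mathbb{D}$ is a complex-valued harmonic function, written uniquely as $f=h+\overline{g}$ with $h,g$ analytic in $\mathbb{D}$ and $g(0)=0$. It is sense-preserving if its Jacobian $|h'|^2-|g'|^2$ is positive in $\mathbb{D}$. All mappings considered are normalized by $f(0)=0$, $f_z(0)=h'(0)=1$, and we write $h(z)=z+\sum_{k\ge2}a_kz^k$, $g(z)=\sum_{k\ge1}b_kz^k$ (so $f_{\overline z}(0)=\overline{b_1}$). A family $\mathscr{F}_H$ of such normalized sense-preserving harmonic mappings is called linear invariant if for each $f=h+\overline g\in\mathscr{F}_H$, all $\theta\in\mathbb{R}$ and all $a\in\mathbb{D}$, the function $$F(z)=\frac{f\left(e^{i\theta}\frac{z+a}{1+\overline{a}z}\right)-f(ae^{i\theta})}{(1-|a|^2)h'(ae^{i\theta})e^{i\theta}}$$ also belongs to $\mathscr{F}_H$. A linear invariant family $\mathscr{F}_H$ is called affine (and linear) invariant if in addition, for each $f\in\mathscr{F}_H$ and each $\epsilon\in\mathbb{D}$, the function $$A(f(z))=\frac{f(z)+\epsilon\overline{f(z)}}{1+\epsilon\overline{f_{\overline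 z}(0)}}$$ also belongs to $\mathscr{F}_H$. For a linear invariant family put $$\overline{\mathrm{ord}}\,\mathscr{F}_H=\sup_{f\in\mathscr{F}_H}\frac{|a_2-\overline{b_1}b_2|}{1-|b_1|^2}.$$ For $\alpha>0$, $\mathscr{U}_H(\alpha)$ is the union of all affine and linear invariant families $\mathscr{F}_H$ of harmonic mappings with $\overline{\mathrm{ord}}\,\mathscr{F}_H\le\alpha$, and $\mathscr{U}^0_H(\alpha)=\{f\in\mathscr{U}_H(\alpha): f_{\overline z}(0)=0\}$. *)

(* Defs.v *)
From Stdlib Require Export Reals Factorial.
From Coquelicot Require Export Coquelicot.

(* Stdlib's classical reals R; C is Coquelicot's type of complex numbers, which
   shadows Stdlib's binomial coefficient of the same name. *)

Open Scope R_scope.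

Definition unit_disc (z : C) : Prop := Cmod z < 1.

(* A function on the unit disc is represented by a total function on C of which
   only the values on [unit_disc] are meaningful. *)

Definition analytic_on_disc (u : C -> C) : Prop :=
  forall z : C, unit_disc z ->
    ex_derive (K := C_AbsRing) (V := C_NormedModule) u z.

(* [ex_diff_n u 2 x y] says that all partial derivatives of order at most 2
   exist and are continuous at (x, y). *)
Definition real_harmonic_on_disc (u : R -> R -> R) : Prop :=
  forall x y : R, unit_disc (x, y) ->
    ex_diff_n u 2 x y /\
    partial_derive 2 0 u x y + partial_derive 0 2 u x y = 0.

Definition harmonic_on_disc (f : C -> C) : Prop :=
  real_harmonic_on_disc (fun x y => Re (f (x, y))) /\
  real_harmonic_on_disc (fun x y => Im (f (x, y))).

Record canonical_decomposition (f h g : C -> C) : Prop := {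
  canonical_h : analytic_on_disc h;
  canonical_g : analytic_on_disc g;
  canonical_g0 : g 0 = 0;
  canonical_eq : forall z : C, unit_disc z -> f z = (h z + Cconj (g z))%C
}.

Definition taylor_coef (u : C -> C) (k : nat) : C :=
  (Nat.iter k C_derive u 0 / INR (fact k))%C.

Definition partial_x (f : C -> C) (z : C) : C :=
  (Derive (fun t => Re (f (t, Im z))) (Re z),
   Derive (fun t => Im (f (t, Im z))) (Re z)).

Definition partial_y (f : C -> C) (z : C) : C :=
  (Derive (fun t => Re (f (Re z, t))) (Im z),
   Derive (fun t => Im (f (Re z, t))) (Im z)).

(* Wirtinger derivative with respect to the conjugate variable. *)
Definition d_zbar (f : C -> C) (z : C) : C :=
  ((partial_x f z + Ci * partial_y f z) / 2)%C.

Definition normalized_sp_harmonic (f : C -> C) : Prop :=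
  harmonic_on_disc f /\ f 0 = 0 /\
  exists h g : C -> C,
    canonical_decomposition f h g /\
    C_derive h 0 = 1 /\
    (forall z : C, unit_disc z ->
       0 < Cmod (C_derive h z) ^ 2 - Cmod (C_derive g z) ^ 2).

Definition cis (t : R) : C := (cos t, sin t).

(* [lif_ext] makes [Fam] a family of functions on the disc: membership does not
   depend on the values outside of it. *)
Record linear_invariant (Fam : (C -> C) -> Prop) : Prop := {
  lif_ext : forall f1 f2 : C -> C,
    (forall z : C, unit_disc z -> f1 z = f2 z) -> Fam f1 -> Fam f2;
  lif_mapping : forall f : C -> C, Fam f -> normalized_sp_harmonic f;
  lif_koebe : forall f h g : C -> C,
    Fam f -> canonical_decomposition f h g ->
    forall (theta : R) (a : C), unit_disc a ->
    Fam (fun z : C =>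
      (f (cis theta * ((z + a) / (1 + Cconj a * z))) - f (a * cis theta)) /
      ((1 - Cmod a ^ 2) * C_derive h (a * cis theta) * cis theta))%C
}.

Record affine_linear_invariant (Fam : (C -> C) -> Prop) : Prop := {
  alif_linear : linear_invariant Fam;
  alif_affine : forall (f : C -> C) (eps : C),
    Fam f -> unit_disc eps ->
    Fam (fun z : C =>
      (f z + eps * Cconj (f z)) / (1 + eps * Cconj (d_zbar f 0)))%C
}.

Definition ord_bar (Fam : (C -> C) -> Prop) : Rbar :=
  Lub_Rbar (fun x : R =>
    exists f h g : C -> C,
      Fam f /\ canonical_decomposition f h g /\
      x = Cmod (taylor_coef h 2 -
                Cconj (taylor_coef g 1) * taylor_coef g 2)%C /
          (1 - Cmod (taylor_coef g 1) ^ 2)).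

Definition U_H (alpha : R) (f : C -> C) : Prop :=
  exists Fam : (C -> C) -> Prop,
    affine_linear_invariant Fam /\ Rbar_le (ord_bar Fam) alpha /\ Fam f.

Definition U_H0 (alpha : R) (f : C -> C) : Prop :=
  U_H alpha f /\ d_zbar f 0 = 0.

(* Main.v *)
(** If [f = h + conj g] lies in a linear invariant family of strong order [alpha],
    the order bound for the Koebe transform of [f] at [a] reads
    [|(1 - |a|^2) (h'' conj h' - g'' conj g') - 2 conj a J| <= 2 alpha J] at [a],
    where [J = |h'|^2 - |g'|^2].  Integrating along radii with [alpha = 33/2],
    [J(0) = 1] gives [J <= (1 + r)^31 / (1 - r)^35].  As [g'(0) = 0], Schwarz's
    lemma for [g' / h'] gives [|g'| <= r |h'|], so [(1 - r^2) |h'|^2 <= J] and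
    [|h'| <= (1 + r)^15 / (1 - r)^18].  Cauchy's estimates for [h'] and [g' / z]
    then bound [n |a_n|] and [n |b_n|] by
    [(1 + r)^15 r^-m (1 - r)^-18] with [m = n - 1], respectively [m = n - 2].
    The constants of the theorem come from the optimal [r] at [n = 3]. *)

Require Import Defs.
From Stdlib Require Import Reals Lra Lia Psatz ZArith List ClassicalEpsilon.
From Coquelicot Require Import Coquelicot.

(** * Complex derivatives *)

(** Analyticity is stated as complex differentiability, from which second derivatives of [h] and [g]
    would need Cauchy's integral formula. The hypotheses also provide the series of [h] and [g], so
    termwise differentiation yields every derivative instead. No contour integral occurs: Cauchy's
    estimate comes from averages over roots of unity, and the maximum principle from a second
    derivative test along real lines. The family grants a positive Jacobian for some decomposition
    of [f], so uniqueness of [h'] and [g'] is needed before the given pair can be used. Maximizing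
    [r^m (1 - r)^18 (1 + r)^-15] leads to [(m + 3) r^2 + 33 r = m], hence [r] is close to [m / 33]
    for small [m]; the tested radii have denominator [n + 30], which is 33 at [n = 3]. For [n >= 40]
    there is enough room for the crude bound [1 + r < 2], while the finitely many smaller [n] are
    settled by exact integer arithmetic. *)

Notation is_Cderive :=
  (is_derive (K := C_AbsRing) (V := C_NormedModule)) (only parsing).

(** Only translates the filter [locally] into balls of [Cmod]; the differentiability estimates made
    by hand below use this form. *)
Lemma is_Cderive_iff (f : C -> C) (z l : C) :
  is_Cderive f z l <->
  forall eps : R, 0 < eps -> exists d : R, 0 < d /\ forall w : C,
    Cmod (w - z)%C < d ->
    Cmod (f w - f z - l * (w - z))%C <= eps * Cmod (w - z)%C.
Proof.
  split.
  - intros [_ H] eps Heps.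
    specialize (H z (fun P HP => HP) (mkposreal eps Heps)).
    apply (locally_norm_le_locally (V := AbsRing_NormedModule C_AbsRing) z) in H.
    destruct H as [d Hd].
    exists d; split; [apply cond_pos |].
    intros w Hw.
    specialize (Hd w Hw). simpl in Hd.
    replace (f w - f z - l * (w - z))%C
      with (minus (minus (f w) (f z)) (scal (minus w z) l)).
    + exact Hd.
    + unfold minus, scal, plus, opp; simpl. unfold mult; simpl. ring.
  - intros H. split.
    + apply (is_linear_scal_l (K := C_AbsRing) (V := C_NormedModule)).
    + intros x Hx.
      assert (x = z) as ->.
      { symmetry. apply (is_filter_lim_locally_unique
          (K := C_AbsRing) (V := AbsRing_NormedModule C_AbsRing)).
        exact Hx. }
      intros eps. destruct (H eps (cond_pos eps)) as [d [Hd0 Hd]].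
      apply (locally_le_locally_norm (V := AbsRing_NormedModule C_AbsRing)).
      exists (mkposreal d Hd0). intros w Hw.
      specialize (Hd w Hw).
      replace (f w - f z - l * (w - z))%C
        with (minus (minus (f w) (f z)) (scal (minus w z) l)) in Hd.
      * exact Hd.
      * unfold minus, scal, plus, opp; simpl. unfold mult; simpl. ring.
Qed.

(** [C] carries two normed module structures over itself. Product and chain rules are phrased with
    the one coming from the ring, the definitions use the other; the underlying data agree, so
    repackaging suffices. *)
Lemma is_Cderive_ring (f : C -> C) (z l : C) :
  is_derive (K := C_AbsRing) (V := AbsRing_NormedModule C_AbsRing) f z l <->
  is_Cderive f z l.
Proof.
  split; intros [[H1 H2 H3] H]; (split; [split |]); assumption.
Qed.

Lemma is_Cderive_eq (f : C -> C) (z l l' : C) :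
  is_Cderive f z l -> l = l' -> is_Cderive f z l'.
Proof. intros H <-; exact H. Qed.

Lemma is_Cderive_const (c z : C) : is_Cderive (fun _ => c) z (RtoC 0).
Proof. apply (is_derive_const (K := C_AbsRing) (V := C_NormedModule)). Qed.

Lemma is_Cderive_id (z : C) : is_Cderive (fun w => w) z (RtoC 1).
Proof. apply is_Cderive_ring, (is_derive_id (K := C_AbsRing)). Qed.

Lemma is_Cderive_plus (f g : C -> C) (z lf lg : C) :
  is_Cderive f z lf -> is_Cderive g z lg ->
  is_Cderive (fun w => f w + g w)%C z (lf + lg)%C.
Proof. apply (is_derive_plus (K := C_AbsRing) (V := C_NormedModule)). Qed.

Lemma is_Cderive_minus (f g : C -> C) (z lf lg : C) :
  is_Cderive f z lf -> is_Cderive g z lg ->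
  is_Cderive (fun w => f w - g w)%C z (lf - lg)%C.
Proof. apply (is_derive_minus (K := C_AbsRing) (V := C_NormedModule)). Qed.

Lemma is_Cderive_mult (f g : C -> C) (z lf lg : C) :
  is_Cderive f z lf -> is_Cderive g z lg ->
  is_Cderive (fun w => f w * g w)%C z (lf * g z + f z * lg)%C.
Proof.
  intros Hf Hg. apply is_Cderive_ring.
  apply (is_derive_mult (K := C_AbsRing)).
  - apply is_Cderive_ring, Hf.
  - apply is_Cderive_ring, Hg.
  - intros; apply Cmult_comm.
Qed.

Lemma is_Cderive_comp (f g : C -> C) (z lf lg : C) :
  is_Cderive f (g z) lf -> is_Cderive g z lg ->
  is_Cderive (fun w => f (g w)) z (lf * lg)%C.
Proof.
  intros Hf Hg.
  apply is_Cderive_eq with (lg * lf)%C; [| ring].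
  apply (is_derive_comp (K := C_AbsRing) (V := C_NormedModule)).
  - exact Hf.
  - apply is_Cderive_ring, Hg.
Qed.

Lemma Cmod_sub_le (x y : C) : Cmod x - Cmod y <= Cmod (x - y)%C.
Proof.
  generalize (Cmod_triangle (x - y) y). replace (x - y + y)%C with x by ring.
  lra.
Qed.

Lemma Cmod_sym (x y : C) : Cmod (x - y)%C = Cmod (y - x)%C.
Proof. rewrite <- Cmod_opp. f_equal. ring. Qed.

Lemma Cmod_pos_neq (z : C) : 0 < Cmod z -> z <> 0.
Proof. intros H ->. rewrite Cmod_0 in H. lra. Qed.

Lemma is_Cderive_Cinv (z : C) : z <> 0 -> is_Cderive Cinv z (- / (z * z))%C.
Proof.
  intros Hz. apply is_Cderive_iff. intros eps Heps.
  set (m := Cmod z).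
  assert (Hm : 0 < m) by (apply Cmod_gt_0, Hz).
  (* The remainder is [(w - z)^2 / (w z^2)]. The first bound keeps [|w| > m / 2], the second then
     makes [|w - z| / |w z^2|] at most [eps]. *)
  exists (Rmin (m / 2) (eps * m ^ 3 / 2)).
  assert (Hm3 : 0 < m ^ 3) by (apply pow_lt, Hm).
  split; [apply Rmin_glb_lt; nra |].
  intros w Hw.
  assert (H1 : Cmod (w - z)%C < m / 2) by (eapply Rlt_le_trans; [exact Hw | apply Rmin_l]).
  assert (H2 : Cmod (w - z)%C < eps * m ^ 3 / 2)
    by (eapply Rlt_le_trans; [exact Hw | apply Rmin_r]).
  assert (H3 : m / 2 < Cmod w).
  { generalize (Cmod_sub_le z w). rewrite Cmod_sym. fold m. lra. }
  assert (Hw0 : w <> 0) by (apply Cmod_pos_neq; lra).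
  replace (/ w - / z - - / (z * z) * (w - z))%C
    with ((w - z) * (w - z) * / (w * (z * z)))%C by (field; auto).
  rewrite !Cmod_mult, Cmod_inv by (repeat apply Cmult_neq_0; auto).
  rewrite !Cmod_mult. fold m.
  generalize (Cmod_ge_0 (w - z)); intros H4.
  set (d := Cmod (w - z)%C) in *. set (v := Cmod w) in *.
  assert (H5 : d * / (v * (m * m)) <= eps).
  { apply Rmult_le_reg_r with (v * (m * m)); [nra |].
    rewrite Rmult_assoc, Rinv_l by nra. simpl in H2. 
    assert (eps * (m / 2 * (m * m)) <= eps * (v * (m * m))); nra. }
  rewrite Rmult_assoc. rewrite (Rmult_comm eps).
  apply Rmult_le_compat_l; assumption.
Qed.

Lemma is_Cderive_div (f g : C -> C) (z lf lg : C) :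
  is_Cderive f z lf -> is_Cderive g z lg -> g z <> 0 ->
  is_Cderive (fun w => f w / g w)%C z ((lf * g z - f z * lg) / (g z * g z))%C.
Proof.
  intros Hf Hg H0.
  eapply is_Cderive_eq.
  - apply is_Cderive_mult; [exact Hf |].
    apply (is_Cderive_comp Cinv g); [apply is_Cderive_Cinv, H0 | exact Hg].
  - cbv beta; field; auto.
Qed.

Lemma is_Cderive_scal (c : C) (f : C -> C) (z l : C) :
  is_Cderive f z l -> is_Cderive (fun w => c * f w)%C z (c * l)%C.
Proof.
  intros H. eapply is_Cderive_eq.
  - apply is_Cderive_mult; [apply is_Cderive_const | exact H].
  - cbv beta; ring.
Qed.

Lemma is_Cderive_ext_ball (f g : C -> C) (z l : C) (d : R) :
  0 < d -> (forall w, Cmod (w - z)%C < d -> f w = g w) ->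
  is_Cderive f z l -> is_Cderive g z l.
Proof.
  intros Hd Heq H. apply is_Cderive_iff. intros eps Heps.
  destruct (proj1 (is_Cderive_iff f z l) H eps Heps) as [d' [Hd' H']].
  exists (Rmin d d'). split; [apply Rmin_glb_lt; auto |].
  intros w Hw.
  rewrite <- !Heq.
  - apply H'. eapply Rlt_le_trans; [exact Hw | apply Rmin_r].
  - replace (z - z)%C with (RtoC 0) by ring. rewrite Cmod_0. exact Hd.
  - eapply Rlt_le_trans; [exact Hw | apply Rmin_l].
Qed.

Lemma is_Cderive_ext_disc (f g : C -> C) (z l : C) :
  unit_disc z -> (forall w, unit_disc w -> f w = g w) ->
  is_Cderive f z l -> is_Cderive g z l.
Proof.
  unfold unit_disc. intros Hz Heq.
  apply is_Cderive_ext_ball with (1 - Cmod z); [lra |].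
  intros w Hw. apply Heq.
  generalize (Cmod_sub_le w z). lra.
Qed.

Lemma is_Cderive_C_derive (f : C -> C) (z : C) :
  ex_derive (K := C_AbsRing) (V := C_NormedModule) f z ->
  is_Cderive f z (C_derive f z).
Proof. apply C_derive_correct. exact z. Qed.

(** * Restriction of complex differentiable functions to real lines *)

Lemma is_derive_R_intro (f : R -> R) (x l : R) :
  (forall eps : R, 0 < eps -> exists d : R, 0 < d /\ forall y : R,
    Rabs (y - x) < d -> Rabs (f y - f x - l * (y - x)) <= eps * Rabs (y - x)) ->
  is_derive f x l.
Proof.
  intros H. split.
  - apply (is_linear_scal_l (K := R_AbsRing) (V := R_NormedModule)).
  - intros z Hz.
    assert (z = x) as ->.
    { symmetry. apply (is_filter_lim_locally_unique
        (K := R_AbsRing) (V := R_NormedModule)). exact Hz. }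
    intros eps. destruct (H eps (cond_pos eps)) as [d [Hd0 Hd]].
    exists (mkposreal d Hd0). intros y Hy. specialize (Hd y Hy).
    replace (f y - f x - l * (y - x))
      with (minus (minus (f y) (f x)) (scal (minus y x) l)) in Hd.
    + exact Hd.
    + unfold minus, scal, plus, opp; simpl. unfold mult; simpl. ring.
Qed.

(** The bridge to real calculus: the second derivative test, the mean value theorem along radii and
    the uniqueness of the decomposition all work with these one-variable functions. *)
Lemma is_derive_Cderive_line (f : C -> C) (p d l : C) (t : R) :
  is_Cderive f (p + t * d)%C l ->
  is_derive (fun s : R => Re (f (p + s * d)%C)) t (Re (l * d)%C) /\
  is_derive (fun s : R => Im (f (p + s * d)%C)) t (Im (l * d)%C).
Proof.
  intros H.
  assert (Hcomp : forall eps : R, 0 < eps -> exists e : R, 0 < e /\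
    forall s : R, Rabs (s - t) < e ->
    Cmod (f (p + s * d) - f (p + t * d) - RtoC (s - t) * (l * d))%C
      <= eps * Rabs (s - t)).
  { intros eps Heps.
    assert (Hd : 0 < Cmod d + 1) by (generalize (Cmod_ge_0 d); lra).
    destruct (proj1 (is_Cderive_iff _ _ _) H (eps / (Cmod d + 1)))
      as [e [He Hf]].
    { apply Rdiv_lt_0_compat; assumption. }
    (* Dividing by [|d| + 1] instead of [|d|] admits the direction [d = 0]. *)
    exists (e / (Cmod d + 1)). split; [apply Rdiv_lt_0_compat; assumption |].
    intros s Hs.
    assert (Hw : ((p + s * d) - (p + t * d))%C = (RtoC (s - t) * d)%C)
      by (rewrite RtoC_minus; ring).
    specialize (Hf (p + s * d)%C). rewrite Hw in Hf.
    rewrite Cmod_mult, Cmod_R in Hf.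
    generalize (Cmod_ge_0 d) (Rabs_pos (s - t)); intros H0 H1.
    replace (RtoC (s - t) * (l * d))%C with (l * (RtoC (s - t) * d))%C by ring.
    eapply Rle_trans; [apply Hf |].
    - apply Rmult_lt_reg_r with (/ (Cmod d + 1)); [apply Rinv_0_lt_compat, Hd |].
      apply Rle_lt_trans with (Rabs (s - t)); [| exact Hs].
      rewrite <- (Rmult_1_r (Rabs (s - t))) at 2. rewrite Rmult_assoc.
      apply Rmult_le_compat_l; [exact H1 |].
      apply Rmult_le_reg_r with (Cmod d + 1); [exact Hd |].
      rewrite Rmult_assoc, Rinv_l by lra. lra.
    - replace (eps / (Cmod d + 1) * (Rabs (s - t) * Cmod d))
        with (eps * Rabs (s - t) * (Cmod d / (Cmod d + 1))) by (field; lra).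
      rewrite <- (Rmult_1_r (eps * Rabs (s - t))) at 2.
      apply Rmult_le_compat_l; [nra |].
      apply Rmult_le_reg_r with (Cmod d + 1); [exact Hd |].
      unfold Rdiv. rewrite Rmult_assoc, Rinv_l by lra. lra. }
  split; apply is_derive_R_intro; intros eps Heps;
    destruct (Hcomp eps Heps) as [e [He Hf]]; exists e; (split; [exact He |]);
    intros s Hs; (eapply Rle_trans; [| exact (Hf s Hs)]).
  - eapply Rle_trans; [| apply re_le_Cmod].
    apply Req_le; f_equal.
    destruct (f (p + s * d)%C), (f (p + t * d)%C), l, d; simpl; ring.
  - eapply Rle_trans; [| eapply Rle_trans; [apply Rmax_r | apply Rmax_Cmod]].
    apply Req_le; f_equal.
    destruct (f (p + s * d)%C), (f (p + t * d)%C), l, d; simpl; ring.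
Qed.

(** * Power series on the disc *)

Notation is_Cseries :=
  (is_series (K := C_AbsRing) (V := C_NormedModule)) (only parsing).

Ltac ring_C :=
  unfold minus, scal, plus, opp, zero; simpl; unfold mult; simpl;
  match goal with |- ?a = ?b => change (@eq C a b) end; ring.

Ltac ring_R :=
  unfold minus, scal, plus, opp, zero; simpl; unfold mult; simpl;
  match goal with |- ?a = ?b => change (@eq R a b) end; ring.

Definition power_series_on_disc (c : nat -> C) (u : C -> C) : Prop :=
  forall z : C, unit_disc z -> is_Cseries (fun k => c k * z ^ k)%C (u z).

Definition derived_coef (c : nat -> C) (k : nat) : C := (INR (S k) * c (S k))%C.

Lemma is_Cseries_eq (a : nat -> C) (l l' : C) :
  is_Cseries a l -> l = l' -> is_Cseries a l'.
Proof. intros H <-; exact H. Qed.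

Lemma is_Cseries_Cmod_le (a : nat -> C) (b : nat -> R) (l : C) (L : R) :
  is_Cseries a l -> is_series b L -> (forall k, Cmod (a k) <= b k) ->
  Cmod l <= L.
Proof.
  intros Ha Hb Hle.
  assert (H : Rbar_le (Cmod l) L); [| exact H].
  apply is_lim_seq_le with (fun n => Cmod (sum_n a n)) (sum_n b).
  - intros n. unfold sum_n. eapply Rle_trans.
    + apply (norm_sum_n_m (K := C_AbsRing) (V := C_NormedModule)).
    + apply sum_n_m_le. exact Hle.
  - eapply filterlim_comp; [exact Ha |].
    apply (filterlim_norm (K := C_AbsRing) (V := C_NormedModule)).
  - exact Hb.
Qed.

(** Convergence at the single point [s] halfway between [r] and 1 bounds the terms there, so the
    radius is at least [s > r]. Passing to the moduli [|c k|] makes the theory of real power series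
    available, in particular that [PS_derive] preserves the radius. *)
Lemma power_series_CV_radius (c : nat -> C) (u : C -> C) (r : R) :
  power_series_on_disc c u -> 0 <= r < 1 ->
  Rbar_lt r (CV_radius (fun k => Cmod (c k))).
Proof.
  intros Hc Hr. set (s := (1 + r) / 2).
  apply Rbar_lt_le_trans with s; [simpl; unfold s; lra |].
  apply (proj1 (CV_radius_bounded (fun k => Cmod (c k)))).
  assert (Hs : unit_disc s).
  { unfold unit_disc. rewrite Cmod_R, Rabs_pos_eq; unfold s; lra. }
  specialize (Hc s Hs).
  destruct (filterlim_bounded (K := C_AbsRing) (V := C_NormedModule) _
    (ex_intro _ _ Hc)) as [M HM].
  (* Each term is a difference of consecutive partial sums, both bounded by [M]. *)
  exists (2 * M). intros n.
  assert (Ht : Rabs (Cmod (c n) * s ^ n) = Cmod (c n * s ^ n)%C).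
  { rewrite Cmod_mult, Cmod_pow, Cmod_R, (Rabs_pos_eq s) by (unfold s; lra).
    apply Rabs_pos_eq, Rmult_le_pos; [apply Cmod_ge_0 |].
    apply pow_le; unfold s; lra. }
  rewrite Ht.
  destruct n as [| n].
  - generalize (HM 0%nat). rewrite sum_O. intros H.
    generalize (norm_ge_0 (K := C_AbsRing) (V := C_NormedModule)
      (c 0%nat * s ^ 0)%C). unfold norm in *; simpl in *. lra.
  - generalize (HM (S n)) (HM n). rewrite sum_Sn. intros H1 H2.
    set (t := (c (S n) * s ^ S n)%C) in *.
    set (S0 := sum_n (fun k : nat => (c k * s ^ k)%C) n) in *.
    replace t with ((S0 + t) - S0)%C by ring.
    eapply Rle_trans; [apply Cmod_triangle |]. rewrite Cmod_opp.
    change (Cmod (S0 + t)%C <= M) in H1.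
    change (Cmod S0 <= M) in H2. lra.
Qed.

Lemma ex_series_CV_radius (a : nat -> R) (r : R) :
  0 <= r -> Rbar_lt r (CV_radius a) -> ex_series (fun k => a k * r ^ k).
Proof.
  intros Hr H.
  assert (H' : Rbar_lt (Rabs r) (CV_radius a)) by (rewrite Rabs_pos_eq; auto).
  apply CV_radius_inside in H'. destruct H' as [l Hl]. exists l.
  eapply is_series_ext; [| exact Hl].
  intros n. etransitivity; [apply Rmult_comm |]. apply f_equal, pow_n_pow.
Qed.

Lemma Cmod_derived_coef (c : nat -> C) (k : nat) :
  Cmod (derived_coef c k) = PS_derive (fun j => Cmod (c j)) k.
Proof.
  unfold derived_coef, PS_derive.
  rewrite Cmod_mult, Cmod_R, Rabs_pos_eq by apply pos_INR. reflexivity.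
Qed.

Lemma power_series_abs (c : nat -> C) (u : C -> C) (r : R) :
  power_series_on_disc c u -> 0 <= r < 1 ->
  ex_series (fun k => Cmod (c k) * r ^ k).
Proof.
  intros Hc Hr. apply ex_series_CV_radius; [lra |].
  eapply power_series_CV_radius; eauto.
Qed.

Lemma power_series_derived_ex (c : nat -> C) (u : C -> C) (z : C) :
  power_series_on_disc c u -> unit_disc z ->
  ex_series (K := C_AbsRing) (V := C_NormedModule)
    (fun k => derived_coef c k * z ^ k)%C.
Proof.
  intros Hc Hz.
  apply (ex_series_le (K := C_AbsRing) (V := C_CompleteNormedModule)) with
    (fun k => PS_derive (fun j => Cmod (c j)) k * Cmod z ^ k).
  - intros n. apply Req_le. rewrite <- Cmod_derived_coef, <- Cmod_pow.
    apply Cmod_mult.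
  - apply ex_series_CV_radius; [apply Cmod_ge_0 |].
    rewrite CV_radius_derive. eapply power_series_CV_radius; eauto.
    split; [apply Cmod_ge_0 | exact Hz].
Qed.

(** Second-order Taylor remainder of a power, by induction on [k]. The sharp constant is half as
    large; without the factor 1/2 the bound is exactly a term of the twice derived series. At
    [k = 0] the truncated [k - 1] is harmless because [INR k] vanishes. *)
Lemma Cmod_pow_sub_le (z w : C) (s : R) (k : nat) :
  Cmod z <= s -> Cmod w <= s ->
  Cmod (w ^ S k - z ^ S k - INR (S k) * z ^ k * (w - z))%C
    <= INR (S k) * INR k * s ^ (k - 1) * Cmod (w - z)%C ^ 2.
Proof.
  intros Hz Hw.
  assert (Hs : 0 <= s) by (eapply Rle_trans; [apply Cmod_ge_0 | exact Hz]).
  generalize (Cmod_ge_0 (w - z)); intros Hd.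
  induction k as [| k IH].
  - simpl. replace (w * 1 - z * 1 - 1 * 1 * (w - z))%C with (RtoC 0) by ring.
    rewrite Cmod_0. apply Req_le; ring.
  - replace (w ^ S (S k) - z ^ S (S k) - INR (S (S k)) * z ^ S k * (w - z))%C
      with (w * (w ^ S k - z ^ S k - INR (S k) * z ^ k * (w - z))
            + INR (S k) * z ^ k * ((w - z) * (w - z)))%C.
    2:{ rewrite (S_INR (S k)), RtoC_plus, !Cpow_S. ring. }
    eapply Rle_trans; [apply Cmod_triangle |].
    rewrite !Cmod_mult, Cmod_pow, Cmod_R, (Rabs_pos_eq (INR (S k))) by apply pos_INR.
    set (d := Cmod (w - z)%C) in *.
    assert (H1 : Cmod z ^ k <= s ^ k)
      by (apply pow_incr; split; [apply Cmod_ge_0 | exact Hz]).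
    assert (H2 : Cmod w * Cmod (w ^ S k - z ^ S k - INR (S k) * z ^ k * (w - z))%C
       <= s * (INR (S k) * INR k * s ^ (k - 1) * d ^ 2)).
    { apply Rmult_le_compat; auto using Cmod_ge_0. }
    assert (H3 : s * (INR (S k) * INR k * s ^ (k - 1) * d ^ 2)
       = INR (S k) * INR k * s ^ k * d ^ 2).
    { destruct k as [| k]; [simpl; ring |].
      replace (S k - 1)%nat with k by lia. simpl; ring. }
    assert (H4 : INR (S k) * Cmod z ^ k * (d * d) <= INR (S k) * s ^ k * (d * d)).
    { apply Rmult_le_compat_r; [nra |].
      apply Rmult_le_compat_l; [apply pos_INR | exact H1]. }
    replace (S k - 1)%nat with k by lia.
    rewrite (S_INR (S k)). rewrite H3 in H2.
    assert (H5 : 0 <= INR (S k) * (s ^ k * d ^ 2)).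
    { apply Rmult_le_pos; [apply pos_INR |].
      apply Rmult_le_pos; [apply pow_le, Hs | nra]. }
    rewrite (S_INR k) in *. simpl (d ^ 2) in *. nra.
Qed.

(** Summing the remainders of the powers gives [|u w - u z - l (w - z)| <= L |w - z|^2] for
    [|w| < s], where [L] is the twice derived series of the moduli at a radius [s] strictly between
    [|z|] and 1. *)
Lemma power_series_derive (c : nat -> C) (u : C -> C) (z l : C) :
  power_series_on_disc c u -> unit_disc z ->
  is_Cseries (fun k => derived_coef c k * z ^ k)%C l -> is_Cderive u z l.
Proof.
  intros Hu Hz Hl. unfold unit_disc in Hz.
  set (s := (1 + Cmod z) / 2).
  assert (Hs : Cmod z < s < 1) by (unfold s; lra).
  generalize (Cmod_ge_0 z); intros Hz0.
  set (a := fun k => Cmod (c k)).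
  assert (Hrad : Rbar_lt s (CV_radius (PS_derive (PS_derive a)))).
  { rewrite !CV_radius_derive. eapply power_series_CV_radius; eauto. lra. }
  apply ex_series_CV_radius in Hrad; [| lra].
  destruct Hrad as [L HL].
  assert (Hbound : forall w, Cmod w < s ->
    Cmod (u w - u z - l * (w - z))%C <= L * Cmod (w - z)%C ^ 2).
  { intros w Hw.
    set (d := (w - z)%C).
    apply is_Cseries_Cmod_le with
      (a := fun k => (c k * w ^ k - c k * z ^ k
              - INR k * c k * z ^ (k - 1) * d)%C)
      (b := fun k => match k with O => 0 | S j =>
         a (S j) * (INR (S j) * INR j * s ^ (j - 1) * Cmod d ^ 2) end).
    - apply (is_series_minus (K := C_AbsRing) (V := C_NormedModule)).
      + apply (is_series_minus (K := C_AbsRing) (V := C_NormedModule)).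
        * apply Hu. unfold unit_disc; lra.
        * apply Hu. exact Hz.
      + apply (is_series_decr_1 (K := C_AbsRing) (V := C_NormedModule)).
        apply (is_series_ext (K := C_AbsRing) (V := C_NormedModule))
          with (fun k => scal d (derived_coef c k * z ^ k)%C).
        * intros k. unfold derived_coef, scal; simpl. unfold mult; simpl.
          replace (k - 0)%nat with k by lia. ring_C.
        * eapply is_Cseries_eq;
            [apply (is_series_scal (K := C_AbsRing) (V := C_NormedModule)), Hl |].
          ring_C.
    (* The terms of index 0 and 1 of the bound are zero, the latter through the factor [INR 0]; what
       remains is the twice derived series. *)
    - apply is_series_decr_1. apply is_series_decr_1.
      apply is_series_ext with
        (fun k => scal (Cmod d ^ 2) (PS_derive (PS_derive a) k * s ^ k)).
      + intros k. replace (S (S k) - 1)%nat with (S k) by lia.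
        unfold PS_derive, a. replace (S k - 1)%nat with k by lia.
        unfold scal; simpl; unfold mult; simpl. ring.
      + replace (plus _ _) with (scal (Cmod d ^ 2) L).
        * apply (is_series_scal (K := R_AbsRing) (V := R_NormedModule)), HL.
        * ring_R.
    - intros [| k].
      + apply Req_le. rewrite <- Cmod_0. apply (f_equal Cmod). simpl (INR 0). ring_C.
      + replace (c (S k) * w ^ S k - c (S k) * z ^ S k
          - INR (S k) * c (S k) * z ^ (S k - 1) * d)%C
          with (c (S k) * (w ^ S k - z ^ S k - INR (S k) * z ^ k * (w - z)))%C.
        2:{ replace (S k - 1)%nat with k by lia. unfold d. ring. }
        rewrite Cmod_mult. apply Rmult_le_compat_l; [apply Cmod_ge_0 |].
        apply Cmod_pow_sub_le; lra. }
  apply is_Cderive_iff. intros eps Heps.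
  (* [|L| + 1] is a positive denominator whatever the sign of [L]. *)
  assert (HL0 : 0 < Rabs L + 1) by (generalize (Rabs_pos L); lra).
  exists (Rmin (s - Cmod z) (eps / (Rabs L + 1))). split.
  { apply Rmin_glb_lt; [lra | apply Rdiv_lt_0_compat; assumption]. }
  intros w Hw.
  assert (H1 : Cmod (w - z)%C < s - Cmod z)
    by (eapply Rlt_le_trans; [exact Hw | apply Rmin_l]).
  assert (H2 : Cmod (w - z)%C < eps / (Rabs L + 1))
    by (eapply Rlt_le_trans; [exact Hw | apply Rmin_r]).
  assert (H3 : (Rabs L + 1) * Cmod (w - z)%C <= eps).
  { apply Rlt_le. apply Rmult_lt_compat_l with (r := Rabs L + 1) in H2; [| exact HL0].
    replace ((Rabs L + 1) * (eps / (Rabs L + 1))) with eps in H2 by (field; lra).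
    exact H2. }
  eapply Rle_trans; [apply Hbound |].
  - generalize (Cmod_sub_le w z). lra.
  - generalize (Cmod_ge_0 (w - z)) (Rle_abs L). intros H4 H5. simpl. nra.
Qed.

(** The conclusion is again a power series, so the lemma can be iterated; this is the source of the
    second derivatives of [h] and [g]. *)
Lemma power_series_C_derive (c : nat -> C) (u : C -> C) :
  power_series_on_disc c u ->
  power_series_on_disc (derived_coef c) (C_derive u) /\
  (forall z, unit_disc z -> is_Cderive u z (C_derive u z)).
Proof.
  intros Hu.
  assert (H : forall z, unit_disc z -> exists l,
    is_Cseries (fun k => derived_coef c k * z ^ k)%C l /\ is_Cderive u z l).
  { intros z Hz. destruct (power_series_derived_ex c u z Hu Hz) as [l Hl].
    exists l. split; [exact Hl |]. eapply power_series_derive; eauto. }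
  split; intros z Hz; destruct (H z Hz) as [l [Hl Hd]];
    rewrite (is_C_derive_unique _ _ _ Hd); assumption.
Qed.

Lemma is_Cseries_at_0 (c : nat -> C) : is_Cseries (fun k => c k * 0 ^ k)%C (c 0%nat).
Proof.
  apply (filterlim_ext (fun _ => c 0%nat)); [| apply filterlim_const].
  induction x as [| n IH].
  - rewrite sum_O. ring_C.
  - rewrite sum_Sn, <- IH. ring_C.
Qed.

Lemma power_series_0 (c : nat -> C) (u : C -> C) :
  power_series_on_disc c u -> u 0 = c 0%nat.
Proof.
  intros Hu.
  assert (H0 : unit_disc 0) by (unfold unit_disc; rewrite Cmod_0; lra).
  exact (filterlim_locally_unique (K := C_AbsRing) (V := C_NormedModule) _ _ _
    (Hu _ H0) (is_Cseries_at_0 c)).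
Qed.

(** * Cauchy's estimate *)

Lemma cis_plus (s t : R) : cis (s + t) = (cis s * cis t)%C.
Proof.
  unfold cis, Cmult; simpl. rewrite cos_plus, sin_plus. f_equal; ring.
Qed.

Lemma cis_0 : cis 0 = 1.
Proof. unfold cis. rewrite cos_0, sin_0. reflexivity. Qed.

Lemma cis_pow (t : R) (n : nat) : (cis t ^ n)%C = cis (INR n * t).
Proof.
  induction n as [| n IH].
  - simpl. rewrite Rmult_0_l, cis_0. reflexivity.
  - rewrite Cpow_S, IH, S_INR, <- cis_plus. f_equal. ring.
Qed.

Lemma Cmod_cis (t : R) : Cmod (cis t) = 1.
Proof.
  unfold Cmod, cis; simpl fst; simpl snd.
  rewrite <- sqrt_1. f_equal. generalize (sin2_cos2 t). unfold Rsqr. lra.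
Qed.

Lemma cis_period (k : nat) : cis (INR k * (2 * PI)) = 1.
Proof.
  rewrite <- cis_pow. replace (cis (2 * PI)) with (RtoC 1).
  - apply Cpow_1_l.
  - unfold cis. rewrite cos_2PI, sin_2PI. reflexivity.
Qed.

Lemma cis_neq_1 (t : R) : 0 < Rabs t < 2 * PI -> cis t <> 1.
Proof.
  intros Ht H. injection H as Hc _.
  replace t with (2 * (t / 2)) in Hc by field.
  rewrite cos_2a_sin in Hc.
  assert (Hs : sin (t / 2) = 0) by nra.
  revert Ht. unfold Rabs. destruct (Rcase_abs t) as [H0 | H0]; intros Ht.
  - assert (0 < sin (- (t / 2))) by (apply sin_gt_0; lra).
    rewrite sin_neg in H. lra.
  - assert (0 < sin (t / 2)) by (apply sin_gt_0; lra). lra.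
Qed.

Lemma sum_n_geom_C (q : C) (N : nat) :
  ((q - 1) * sum_n (G := C_AbelianMonoid) (fun j => q ^ j)%C N)%C = (q ^ S N - 1)%C.
Proof.
  induction N as [| N IH].
  - rewrite sum_O. simpl. ring.
  - rewrite sum_Sn. change (@plus C_AbelianMonoid) with Cplus.
    rewrite Cmult_plus_distr_l, IH, !Cpow_S. ring.
Qed.

(** Orthogonality of characters: for [k <> n] this is a geometric sum whose ratio [q] satisfies
    [q^(N+1) = 1], and [q <> 1] because [|k - n| <= N]. *)
Lemma sum_n_roots_of_unity (N k n : nat) :
  (k <= N)%nat -> (n <= N)%nat ->
  sum_n (G := C_AbelianMonoid)
    (fun j => cis (INR j * ((INR k - INR n) * (2 * PI) / INR (S N)))) N
  = if Nat.eq_dec k n then RtoC (INR (S N)) else RtoC 0.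
Proof.
  intros Hk Hn.
  assert (HN : 0 < INR (S N)) by (apply lt_0_INR; lia).
  destruct (Nat.eq_dec k n) as [-> | Hkn].
  - rewrite (sum_n_ext _ (fun _ => RtoC 1)).
    + clear. induction N as [| N IH]; [rewrite sum_O; reflexivity |].
      rewrite sum_Sn, IH, (S_INR (S N)), RtoC_plus. reflexivity.
    + intros j. rewrite <- cis_0. f_equal. field. lra.
  - set (t := (INR k - INR n) * (2 * PI) / INR (S N)).
    rewrite (sum_n_ext _ (fun j => cis t ^ j)%C) by (intros; rewrite cis_pow; reflexivity).
    assert (Hq : cis t <> 1).
    { apply cis_neq_1. unfold t, Rdiv.
      rewrite !Rabs_mult, Rabs_inv, (Rabs_pos_eq (INR (S N))),
        (Rabs_pos_eq 2), (Rabs_pos_eq PI) by (generalize PI_RGT_0; lra).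
      assert (H : 0 < Rabs (INR k - INR n) < INR (S N)).
      { apply le_INR in Hk, Hn. rewrite S_INR.
        generalize (pos_INR k) (pos_INR n); intros.
        split; [apply Rabs_pos_lt; intros E; apply Hkn, INR_eq; lra |].
        apply Rabs_def1; lra. }
      set (m := Rabs (INR k - INR n)) in *. set (M := INR (S N)) in *.
      generalize PI_RGT_0; intros HPI.
      replace (m * (2 * PI) * / M) with (2 * PI * (m / M)) by (field; lra).
      assert (0 < m / M) by (apply Rdiv_lt_0_compat; lra).
      assert (m / M < 1) by (apply Rmult_lt_reg_r with M; [lra |];
        unfold Rdiv; rewrite Rmult_assoc, Rinv_l; lra).
      split; nra. }
    assert (Hp : (cis t ^ S N)%C = 1).
    { rewrite cis_pow. unfold t.
      replace (INR (S N) * ((INR k - INR n) * (2 * PI) / INR (S N)))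
        with (INR k * (2 * PI) + - (INR n * (2 * PI))) by (field; lra).
      rewrite cis_plus, cis_period.
      assert (E : cis (INR n * (2 * PI) + - (INR n * (2 * PI))) = 1)
        by (rewrite Rplus_opp_r; apply cis_0).
      rewrite cis_plus, cis_period in E. exact E. }
    generalize (sum_n_geom_C (cis t) N). rewrite Hp. intros E.
    set (S0 := sum_n _ N) in *.
    assert (Hd : (cis t - 1)%C <> 0).
    { intros E0. apply Hq. replace (cis t) with (cis t - 1 + 1)%C by ring.
      rewrite E0. ring. }
    change (S0 = RtoC 0).
    replace S0 with ((cis t - 1) * S0 / (cis t - 1))%C by (field; exact Hd).
    rewrite E. match goal with |- ?a = ?b => change (@eq C a b) end; field; exact Hd.
Qed.

Lemma Cmod_sum_n_le (a : nat -> C) (M : R) (N : nat) :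
  (forall j, Cmod (a j) <= M) ->
  Cmod (sum_n (G := C_AbelianMonoid) a N) <= INR (S N) * M.
Proof.
  intros H. induction N as [| N IH].
  - rewrite sum_O. simpl. rewrite Rmult_1_l. apply H.
  - rewrite sum_Sn, (S_INR (S N)).
    eapply Rle_trans; [apply Cmod_triangle |]. specialize (H (S N)). lra.
Qed.

(** A discrete Cauchy formula: averaging [p] against the conjugate character over [N + 1] equally
    spaced points of the circle isolates [c n r^n] exactly, since there are more points than the
    degree of [p]. *)
Lemma Cauchy_estimate_poly (c : nat -> C) (r M : R) (N n : nat) :
  0 <= r -> (n <= N)%nat ->
  (forall z, Cmod z = r ->
    Cmod (sum_n (G := C_AbelianMonoid) (fun k => c k * z ^ k)%C N) <= M) ->
  Cmod (c n) * r ^ n <= M.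
Proof.
  intros Hr Hn HM.
  assert (HN : 0 < INR (S N)) by (apply lt_0_INR; lia).
  set (th := 2 * PI / INR (S N)).
  set (p := fun z => sum_n (G := C_AbelianMonoid) (fun k => c k * z ^ k)%C N).
  set (avg := sum_n (G := C_AbelianMonoid)
    (fun j => cis (- (INR j * INR n * th)) * p (r * cis (INR j * th)))%C N).
  assert (Havg : avg = (INR (S N) * (c n * r ^ n))%C).
  { transitivity (sum_n (G := C_AbelianMonoid) (fun j =>
      sum_n (G := C_AbelianMonoid) (fun k =>
        (c k * r ^ k) * cis (INR j * ((INR k - INR n) * (2 * PI) / INR (S N))))%C N) N).
    { apply sum_n_ext. intros j. unfold p.
      etransitivity; [symmetry; apply (sum_n_mult_l (K := C_Ring)) |].
      apply sum_n_ext. intros k.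
      change ((cis (- (INR j * INR n * th)) * (c k * (r * cis (INR j * th)) ^ k))%C
        = (c k * r ^ k * cis (INR j * ((INR k - INR n) * (2 * PI) / INR (S N))))%C).
      rewrite Cpow_mult_l, cis_pow.
      replace (INR j * ((INR k - INR n) * (2 * PI) / INR (S N)))
        with (- (INR j * INR n * th) + INR k * (INR j * th))
        by (unfold th; field; lra).
      rewrite cis_plus. ring. }
    rewrite sum_n_switch.
    transitivity (sum_n (G := C_AbelianMonoid)
      (fun k => if Nat.eq_dec k n then INR (S N) * (c n * r ^ n) else RtoC 0)%C N).
    { apply sum_n_ext_loc. intros k Hk.
      etransitivity; [apply (sum_n_mult_l (K := C_Ring)) |].
      rewrite sum_n_roots_of_unity by assumption.
      change (@mult C_Ring) with Cmult.
      destruct (Nat.eq_dec k n) as [-> |]; ring_C. }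
    clear - Hn. set (v := (INR (S N) * (c n * r ^ n))%C). clearbody v.
    assert (H : forall m, sum_n (G := C_AbelianMonoid)
      (fun k => if Nat.eq_dec k n then v else RtoC 0) m
      = if Compare_dec.le_dec n m then v else RtoC 0).
    { induction m as [| m IH].
      - rewrite sum_O. destruct (Nat.eq_dec 0 n), (Compare_dec.le_dec n 0); lia || reflexivity.
      - rewrite sum_Sn, IH. change (@plus C_AbelianMonoid) with Cplus.
        destruct (Compare_dec.le_dec n m), (Nat.eq_dec (S m) n), (Compare_dec.le_dec n (S m));
          try lia; ring_C. }
    rewrite H. destruct (Compare_dec.le_dec n N); [reflexivity | lia]. }
  assert (Hle : Cmod avg <= INR (S N) * M).
  { apply Cmod_sum_n_le. intros j.
    rewrite Cmod_mult, Cmod_cis, Rmult_1_l. apply HM.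
    rewrite Cmod_mult, Cmod_cis, Cmod_R, Rabs_pos_eq by exact Hr. ring. }
  rewrite Havg, !Cmod_mult, Cmod_pow, !Cmod_R, (Rabs_pos_eq r),
    (Rabs_pos_eq (INR (S N))) in Hle by lra.
  apply Rmult_le_reg_l with (INR (S N)); assumption.
Qed.

Lemma Cauchy_estimate (c : nat -> C) (u : C -> C) (r M : R) (n : nat) :
  power_series_on_disc c u -> 0 <= r < 1 ->
  (forall z, Cmod z = r -> Cmod (u z) <= M) ->
  Cmod (c n) * r ^ n <= M.
Proof.
  intros Hu Hr HM.
  destruct (power_series_abs c u r Hu Hr) as [L HL].
  apply le_epsilon. intros eps Heps.
  destruct (proj1 (filterlim_locally _ _) HL (mkposreal eps Heps)) as [N0 HN0].
  (* The partial sum must contain the index [n] and be within [eps] of [u] on the whole circle; the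
     tail of the absolute series gives the latter uniformly. *)
  set (N := max n N0).
  specialize (HN0 N (Nat.le_max_r _ _)).
  apply Cauchy_estimate_poly with N; [lra | apply Nat.le_max_l |].
  intros z Hz.
  assert (Hz1 : unit_disc z) by (unfold unit_disc; lra).
  set (P := sum_n (G := C_AbelianMonoid) (fun k => c k * z ^ k)%C N).
  assert (Htail : Cmod (u z - P)%C <= L - sum_n (fun k => Cmod (c k) * r ^ k) N).
  { apply is_Cseries_Cmod_le with
      (a := fun k => (c (S N + k)%nat * z ^ (S N + k))%C)
      (b := fun k => Cmod (c (S N + k)%nat) * r ^ (S N + k)).
    - apply (is_series_incr_n (K := C_AbsRing) (V := C_NormedModule)
        (fun k => c k * z ^ k)%C); [lia |].
      eapply is_Cseries_eq; [apply Hu, Hz1 |].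
      simpl Nat.pred. change (u z = (u z - P + P)%C). ring.
    - apply (is_series_incr_n (fun k => Cmod (c k) * r ^ k)); [lia |].
      simpl Nat.pred.
      replace (plus _ _) with L; [exact HL |].
      assert (E : forall x y : R, x = x - y + y) by (intros; ring). apply E.
    - intros k. rewrite Cmod_mult, Cmod_pow, Hz. apply Rle_refl. }
  assert (HL' : L - sum_n (fun k => Cmod (c k) * r ^ k) N < eps).
  { change (Rabs (sum_n (fun k => Cmod (c k) * r ^ k) N - L) < eps) in HN0.
    apply Rabs_def2 in HN0. lra. }
  replace P with (u z - (u z - P))%C by ring.
  eapply Rle_trans; [apply Cmod_triangle |]. rewrite Cmod_opp.
  specialize (HM z Hz). lra.
Qed.

(** * The maximum principle *)

Lemma second_derivative_local_max (phi dphi : R -> R) (c e : R) :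
  0 < e -> (forall t, Rabs t < e -> is_derive phi t (dphi t)) ->
  is_derive dphi 0 c -> (forall t, Rabs t < e -> phi t <= phi 0) -> c <= 0.
Proof.
  intros He Hphi Hdphi Hmax.
  assert (H0 : Rabs 0 < e) by (rewrite Rabs_R0; exact He).
  assert (Hcrit : dphi 0 = 0).
  { assert (Hl : derivable_pt_lim phi 0 (dphi 0)) by (apply is_derive_Reals, Hphi, H0).
    set (pr := exist _ (dphi 0) Hl : derivable_pt phi 0).
    rewrite <- (derive_pt_eq_0 phi 0 (dphi 0) pr Hl).
    apply deriv_maximum with (- e) e; try lra.
    intros x H1 H2. apply Hmax, Rabs_def1; lra. }
  apply Rnot_lt_le. intros Hc.
  apply is_derive_Reals in Hdphi.
  (* If [c > 0], the quotients [dphi s / s] stay above [c / 2] near 0, so [dphi] is positive to the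
     right of 0 and the mean value theorem yields [phi t > phi 0]. *)
  destruct (Hdphi (c / 2) ltac:(lra)) as [d Hd].
  set (t := Rmin (d / 2) (e / 2)).
  assert (Ht : 0 < t /\ t < d /\ t < e).
  { generalize (cond_pos d) (Rmin_l (d / 2) (e / 2)) (Rmin_r (d / 2) (e / 2)).
    intros. split; [apply Rmin_glb_lt |]; unfold t; lra. }
  destruct (MVT_cor2 phi dphi 0 t) as [s [E Hs]]; [lra | |].
  { intros x Hx. apply is_derive_Reals, Hphi, Rabs_def1; lra. }
  assert (Hm : phi t <= phi 0) by (apply Hmax, Rabs_def1; lra).
  assert (Hsd : Rabs s < d) by (apply Rabs_def1; lra).
  specialize (Hd s (Rgt_not_eq _ _ (proj1 Hs)) Hsd).
  rewrite Hcrit, Rplus_0_l, Rminus_0_r in Hd. apply Rabs_def2 in Hd.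
  assert (Hpos : 0 < dphi s).
  { replace (dphi s) with (dphi s / s * s) by (field; apply Rgt_not_eq; lra).
    apply Rmult_lt_0_compat; lra. }
  assert (0 < dphi s * (t - 0)) by (apply Rmult_lt_0_compat; lra). lra.
Qed.

Lemma is_derive_dot (a b a1 b1 : R -> R) (t da db da1 db1 : R) :
  is_derive a t da -> is_derive b t db ->
  is_derive a1 t da1 -> is_derive b1 t db1 ->
  is_derive (fun s => a s * a1 s + b s * b1 s) t
    (da * a1 t + a t * da1 + (db * b1 t + b t * db1)).
Proof.
  intros Ha Hb Ha1 Hb1.
  apply (is_derive_plus (K := R_AbsRing) (V := R_NormedModule));
    apply (is_derive_mult (K := R_AbsRing)); auto; apply Rmult_comm.
Qed.

Lemma Cmod_sqr (z : C) : Cmod z ^ 2 = Re z * Re z + Im z * Im z.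
Proof.
  unfold Cmod. rewrite pow2_sqrt; [unfold Re, Im; ring |].
  apply Rplus_le_le_0_compat; apply pow2_ge_0.
Qed.

Lemma is_derive_Cmod_sqr_line (F : C -> C) (z d l : C) (t : R) :
  is_Cderive F (z + t * d)%C l ->
  is_derive (fun s : R => Cmod (F (z + s * d)%C) ^ 2) t
    (2 * (Re (F (z + t * d)%C) * Re (l * d)%C + Im (F (z + t * d)%C) * Im (l * d)%C)).
Proof.
  intros H. apply is_derive_Cderive_line in H. destruct H as [H1 H2].
  apply (is_derive_ext (K := R_AbsRing) (V := R_NormedModule) _ _ _ _
    (fun s : R => eq_sym (Cmod_sqr (F (z + s * d)%C)))).
  generalize (is_derive_dot _ _ _ _ t _ _ _ _ H1 H2 H1 H2).
  intros H. match goal with |- is_derive _ _ ?x => match type of H with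
    is_derive _ _ ?y => replace x with y by ring end end. exact H.
Qed.

(** The second derivative at [t = 0] of [|F (z + t d)|^2], with [F0], [F1], [F2] the values of [F],
    [F'], [F''] at [z]. Adding the cases [d = 1] and [d = i] cancels the [F2] terms, as [i^2 = -1],
    and leaves the Laplacian [4 |F'|^2]. *)
Definition d2_Cmod_sqr (F0 F1 F2 d : C) : R :=
  2 * (Re (F1 * d)%C ^ 2 + Im (F1 * d)%C ^ 2
       + Re F0 * Re (F2 * d * d)%C + Im F0 * Im (F2 * d * d)%C).

Lemma is_derive2_Cmod_sqr_line (F F1 : C -> C) (z d F2 : C) :
  is_Cderive F z (F1 z) -> is_Cderive F1 z F2 ->
  is_derive (fun t : R =>
    2 * (Re (F (z + t * d)%C) * Re (F1 (z + t * d) * d)%C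
         + Im (F (z + t * d)%C) * Im (F1 (z + t * d) * d)%C)) 0
    (d2_Cmod_sqr (F z) (F1 z) F2 d).
Proof.
  intros H1 H2.
  assert (Ez : z = (z + RtoC 0 * d)%C) by ring.
  assert (H3 : is_Cderive (fun w => d * F1 w)%C z (d * F2)%C)
    by (apply is_Cderive_scal, H2).
  rewrite Ez in H1, H3 at 1.
  apply is_derive_Cderive_line in H1. apply is_derive_Cderive_line in H3.
  destruct H1 as [H1 H1']. destruct H3 as [H3 H3'].
  generalize (is_derive_dot _ _ _ _ 0 _ _ _ _ H1 H1' H3 H3').
  intros H. apply (is_derive_scal _ _ 2) in H.
  eapply (is_derive_ext (K := R_AbsRing) (V := R_NormedModule));
    [| match goal with |- is_derive _ _ ?x => match type of H with
    is_derive _ _ ?y => replace x with y; [exact H |] end end].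
  - intros t. cbv beta. rewrite (Cmult_comm (F1 _)). reflexivity.
  - rewrite <- Ez. unfold d2_Cmod_sqr.
    unfold scal; simpl; unfold mult; simpl.
    destruct (F z), (F1 z), F2, d; simpl; ring.
Qed.

Lemma Cmod_Ci : Cmod Ci = 1.
Proof.
  unfold Cmod, Ci; simpl fst; simpl snd.
  replace (0 ^ 2 + 1 ^ 2) with 1 by ring. apply sqrt_1.
Qed.

(* The Laplacian of |F|^2 + eps |z|^2 is 4 |F'|^2 + 4 eps > 0. *)
Lemma no_interior_max (F F1 : C -> C) (z F2 : C) (eps e : R) :
  0 < eps -> 0 < e ->
  (forall w, Cmod (w - z)%C < e -> is_Cderive F w (F1 w)) ->
  is_Cderive F1 z F2 ->
  ~ (forall w, Cmod (w - z)%C < e ->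
       Cmod (F w) ^ 2 + eps * Cmod w ^ 2 <= Cmod (F z) ^ 2 + eps * Cmod z ^ 2).
Proof.
  intros Heps He HF HF1 Hmax.
  assert (Hline : forall d, Cmod d = 1 ->
    d2_Cmod_sqr (F z) (F1 z) F2 d + eps * d2_Cmod_sqr z 1 0 d <= 0).
  { intros d Hd.
    assert (Hball : forall t : R, Rabs t < e -> Cmod ((z + t * d) - z)%C < e).
    { intros t Ht. replace (z + t * d - z)%C with (t * d)%C by ring.
      rewrite Cmod_mult, Cmod_R, Hd, Rmult_1_r. exact Ht. }
    assert (Ez : (z + RtoC 0 * d)%C = z) by ring.
    apply second_derivative_local_max with
      (phi := fun t : R => Cmod (F (z + t * d)%C) ^ 2 + eps * Cmod (z + t * d)%C ^ 2)
      (dphi := fun t : R =>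
        2 * (Re (F (z + t * d)%C) * Re (F1 (z + t * d) * d)%C
         + Im (F (z + t * d)%C) * Im (F1 (z + t * d) * d)%C)
        + eps * (2 * (Re (z + t * d)%C * Re (1 * d)%C
                      + Im (z + t * d)%C * Im (1 * d)%C)))
      (e := e); auto.
    - intros t Ht.
      apply (is_derive_plus (K := R_AbsRing) (V := R_NormedModule)).
      + apply is_derive_Cmod_sqr_line, HF, Hball, Ht.
      + apply is_derive_scal.
        apply (is_derive_Cmod_sqr_line (fun w => w)), is_Cderive_id.
    - apply (is_derive_plus (K := R_AbsRing) (V := R_NormedModule)).
      + apply is_derive2_Cmod_sqr_line; [apply HF | exact HF1].
        replace (z - z)%C with (RtoC 0) by ring. rewrite Cmod_0. exact He.
      + apply is_derive_scal.
        apply (is_derive2_Cmod_sqr_line (fun w => w) (fun _ => 1));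
          [apply is_Cderive_id | apply is_Cderive_const].
    - intros t Ht. rewrite Ez. apply Hmax, Hball, Ht. }
  generalize (Hline 1 Cmod_1)
    (Hline Ci Cmod_Ci).
  unfold d2_Cmod_sqr. destruct (F z), (F1 z), F2, z. simpl. nra.
Qed.

(** Compactness as a passage from local to uniform: a margin [d] available near each point of the
    disc can be chosen once for all. It follows from compactness of the enclosing square, for a
    gauge function [delta]. *)
Lemma closed_disc_gauge (rho : R) (Q : C -> R -> Prop) :
  (forall w d d', 0 < d <= d' -> Q w d' -> Q w d) ->
  (forall u, Cmod u <= rho -> exists d, 0 < d /\
     forall w, Cmod w <= rho -> Cmod (w - u)%C < d -> Q w d) ->
  exists d, 0 < d /\ forall w, Cmod w <= rho -> Q w d.
Proof.
  intros Hmono Hloc.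
  assert (Hall : forall u, exists d : posreal,
     forall w, Cmod w <= rho -> Cmod (w - u)%C < 2 * d -> Q w d).
  { intros u. destruct (Rle_lt_dec (Cmod u) rho) as [Hu | Hu].
    - destruct (Hloc u Hu) as [d [Hd Hd']].
      exists (mkposreal (d / 2) ltac:(lra)). simpl. intros w Hw Hwu.
      apply Hmono with d; [lra |]. apply Hd'; [exact Hw | lra].
    (* A centre outside the disc gets a ball so small that it misses the disc, and the requirement
       is vacuous. *)
    - exists (mkposreal ((Cmod u - rho) / 2) ltac:(lra)). simpl. intros w Hw Hwu.
      generalize (Cmod_sub_le u w). rewrite Cmod_sym. lra. }
  set (delta := fun x y : R => proj1_sig
    (constructive_indefinite_description _ (Hall (x, y)))).
  assert (Hdelta : forall x y w, Cmod w <= rho ->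
    Cmod (w - (x, y))%C < 2 * delta x y -> Q w (delta x y)).
  { intros x y. unfold delta.
    exact (proj2_sig (constructive_indefinite_description _ (Hall (x, y)))). }
  destruct (compactness_value_2d (- rho) rho (- rho) rho delta) as [d Hd].
  exists d. split; [apply cond_pos |].
  intros w Hw. apply NNPP. intros HQ.
  generalize (Rmax_Cmod w) (Rmax_l (Rabs (fst w)) (Rabs (snd w)))
    (Rmax_r (Rabs (fst w)) (Rabs (snd w))). intros H0 H1 H2.
  apply (Hd (fst w) (snd w)).
  { apply (proj1 (Rabs_le_between _ _)). lra. }
  { apply (proj1 (Rabs_le_between _ _)). lra. }
  intros [u [v [_ [_ [Hu [Hv Huv]]]]]]. apply HQ.
  apply Hmono with (delta u v); [split; [apply cond_pos | exact Huv] |].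
  apply Hdelta; [exact Hw |].
  eapply Rle_lt_trans; [apply Cmod_2Rmax |].
  change (fst (w - (u, v))%C) with (fst w - u).
  change (snd (w - (u, v))%C) with (snd w - v).
  assert (Hm : Rmax (Rabs (fst w - u)) (Rabs (snd w - v)) < delta u v)
    by (apply Rmax_lub_lt; assumption).
  (* The square covering measures distance by the larger coordinate; [Cmod] exceeds it by a factor
     at most [sqrt 2], which is why the gauge was prepared on balls of radius [2 * delta]. *)
  assert (Hs : sqrt 2 <= 2).
  { apply Rlt_le, sqrt_less_alt. lra. }
  generalize (Rmax_l (Rabs (fst w - u)) (Rabs (snd w - v))) (Rabs_pos (fst w - u)).
  intros. generalize (sqrt_pos 2). intros. nra.
Qed.

(** Two uses of the gauge lemma: with [Phi w <= / d] it gives boundedness; if the supremum [M] were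
    not attained, [Phi w <= M - d] would hold with a uniform [d > 0], which is absurd. *)
Lemma closed_disc_max (rho : R) (Phi : C -> R) :
  0 <= rho ->
  (forall u, Cmod u <= rho -> forall eps, 0 < eps -> exists d, 0 < d /\
     forall w, Cmod (w - u)%C < d -> Rabs (Phi w - Phi u) < eps) ->
  exists z, Cmod z <= rho /\ forall w, Cmod w <= rho -> Phi w <= Phi z.
Proof.
  intros Hrho Hcont.
  assert (Hbound : exists d, 0 < d /\ forall w, Cmod w <= rho -> Phi w <= / d).
  { apply closed_disc_gauge.
    - intros w d d' Hd H. eapply Rle_trans; [exact H |].
      apply Rinv_le_contravar; lra.
    - intros u Hu. destruct (Hcont u Hu 1 Rlt_0_1) as [d [Hd Hd']].
      set (b := Rabs (Phi u) + 1).
      assert (Hb : 0 < b) by (unfold b; generalize (Rabs_pos (Phi u)); lra).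
      exists (Rmin d (/ b)). split.
      { apply Rmin_glb_lt; [exact Hd | apply Rinv_0_lt_compat, Hb]. }
      intros w _ Hw.
      apply Rle_trans with b.
      + assert (H : Cmod (w - u)%C < d)
          by (eapply Rlt_le_trans; [exact Hw | apply Rmin_l]).
        apply Hd', Rabs_def2 in H. unfold b. generalize (Rle_abs (Phi u)). lra.
      + apply Rle_trans with (/ / b); [rewrite Rinv_inv; apply Rle_refl |].
        apply Rinv_le_contravar; [| apply Rmin_r].
        apply Rmin_glb_lt; [exact Hd | apply Rinv_0_lt_compat, Hb]. }
  destruct Hbound as [d0 [Hd0 Hbound]].
  destruct (completeness (fun y => exists w, Cmod w <= rho /\ y = Phi w)) as [M [HM1 HM2]].
  { exists (/ d0). intros y [w [Hw ->]]. auto. }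
  { exists (Phi 0), 0. rewrite Cmod_0. auto. }
  apply NNPP. intros Hno.
  assert (Hlt : forall u, Cmod u <= rho -> Phi u < M).
  { intros u Hu. apply Rnot_le_lt. intros H. apply Hno. exists u.
    split; [exact Hu |]. intros w Hw. eapply Rle_trans; [| exact H].
    apply HM1. exists w; auto. }
  destruct (closed_disc_gauge rho (fun w d => Phi w <= M - d)) as [d [Hd H]].
  - intros; lra.
  - intros u Hu. specialize (Hlt u Hu).
    destruct (Hcont u Hu ((M - Phi u) / 2)) as [d [Hd Hd']]; [lra |].
    exists (Rmin d ((M - Phi u) / 2)). split; [apply Rmin_glb_lt; lra |].
    intros w _ Hw.
    assert (H : Cmod (w - u)%C < d)
      by (eapply Rlt_le_trans; [exact Hw | apply Rmin_l]).
    apply Hd', Rabs_def2 in H. generalize (Rmin_r d ((M - Phi u) / 2)). lra.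
  - assert (M <= M - d); [| lra]. apply HM2. intros y [w [Hw ->]]. auto.
Qed.

Lemma Cderive_continuous (F : C -> C) (z l : C) :
  is_Cderive F z l -> forall eps, 0 < eps -> exists d, 0 < d /\
    forall w, Cmod (w - z)%C < d -> Cmod (F w - F z)%C < eps.
Proof.
  intros H eps Heps.
  destruct (proj1 (is_Cderive_iff _ _ _) H 1 Rlt_0_1) as [d [Hd Hd']].
  set (k := Cmod l + 1).
  assert (Hk : 0 < k) by (unfold k; generalize (Cmod_ge_0 l); lra).
  exists (Rmin d (eps / k)). split.
  { apply Rmin_glb_lt; [exact Hd | apply Rdiv_lt_0_compat; assumption]. }
  intros w Hw.
  assert (H1 : Cmod (w - z)%C < d) by (eapply Rlt_le_trans; [exact Hw | apply Rmin_l]).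
  assert (H2 : Cmod (w - z)%C < eps / k)
    by (eapply Rlt_le_trans; [exact Hw | apply Rmin_r]).
  specialize (Hd' w H1).
  replace (F w - F z)%C with ((F w - F z - l * (w - z)) + l * (w - z))%C by ring.
  eapply Rle_lt_trans; [apply Cmod_triangle |]. rewrite Cmod_mult.
  apply Rmult_lt_compat_l with (r := k) in H2; [| exact Hk].
  replace (k * (eps / k)) with eps in H2 by (field; lra).
  unfold k in H2. lra.
Qed.

Lemma Rabs_sqr_sub_lt (y eps : R) :
  0 < eps -> exists d, 0 < d /\ forall x, Rabs (x - y) < d -> Rabs (x ^ 2 - y ^ 2) < eps.
Proof.
  intros Heps.
  set (k := 2 * Rabs y + 1).
  assert (Hk : 0 < k) by (unfold k; generalize (Rabs_pos y); lra).
  exists (Rmin 1 (eps / k)). split.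
  { apply Rmin_glb_lt; [lra | apply Rdiv_lt_0_compat; assumption]. }
  intros s Hs.
  assert (H1 : Rabs (s - y) < 1) by (eapply Rlt_le_trans; [exact Hs | apply Rmin_l]).
  assert (H2 : Rabs (s - y) < eps / k)
    by (eapply Rlt_le_trans; [exact Hs | apply Rmin_r]).
  replace (s ^ 2 - y ^ 2) with ((s - y) * ((s - y) + 2 * y)) by ring.
  rewrite Rabs_mult.
  assert (H3 : Rabs (s - y + 2 * y) <= k).
  { eapply Rle_trans; [apply Rabs_triang |].
    rewrite Rabs_mult, (Rabs_pos_eq 2) by lra. unfold k. lra. }
  apply Rmult_lt_compat_l with (r := k) in H2; [| exact Hk].
  replace (k * (eps / k)) with eps in H2 by (field; lra).
  generalize (Rabs_pos (s - y)). nra.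
Qed.

Lemma Cmod_sqr_continuous (F : C -> C) (z l : C) :
  is_Cderive F z l -> forall eps, 0 < eps -> exists d, 0 < d /\
    forall w, Cmod (w - z)%C < d -> Rabs (Cmod (F w) ^ 2 - Cmod (F z) ^ 2) < eps.
Proof.
  intros H eps Heps.
  destruct (Rabs_sqr_sub_lt (Cmod (F z)) eps Heps) as [e [He He']].
  destruct (Cderive_continuous _ _ _ H e He) as [d [Hd Hd']].
  exists d. split; [exact Hd |]. intros w Hw. apply He'.
  specialize (Hd' w Hw). generalize (Cmod_sub_le (F w) (F z)) (Cmod_sub_le (F z) (F w)).
  rewrite (Cmod_sym (F z)). intros. apply Rabs_def1; lra.
Qed.

(** The perturbation [eps |z|^2] makes the Laplacian strictly positive, so the maximum of
    [|F|^2 + eps |z|^2] lies on the circle; then [eps] tends to 0. *)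
Lemma maximum_modulus (F F1 F2 : C -> C) (rho B : R) :
  0 <= rho -> 0 <= B ->
  (forall z, Cmod z <= rho -> is_Cderive F z (F1 z)) ->
  (forall z, Cmod z <= rho -> is_Cderive F1 z (F2 z)) ->
  (forall z, Cmod z = rho -> Cmod (F z) <= B) ->
  forall z, Cmod z <= rho -> Cmod (F z) <= B.
Proof.
  intros Hrho HB HF HF1 Hbd z Hz.
  assert (Hsq : Cmod (F z) ^ 2 <= B ^ 2).
  { apply le_epsilon. intros eps0 Heps0.
    (* Chosen so that [eps * rho^2 <= eps0]; the [+ 1] covers [rho = 0]. *)
    set (eps := eps0 / (rho ^ 2 + 1)).
    assert (Hr1 : 0 < rho ^ 2 + 1) by (generalize (pow2_ge_0 rho); lra).
    assert (Heps : 0 < eps) by (apply Rdiv_lt_0_compat; assumption).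
    destruct (closed_disc_max rho (fun w => Cmod (F w) ^ 2 + eps * Cmod w ^ 2))
      as [z0 [Hz0 Hmax]]; [exact Hrho | |].
    { intros u Hu e He.
      destruct (Cmod_sqr_continuous F u _ (HF u Hu) (e / 2) ltac:(lra)) as [d1 [Hd1 H1]].
      destruct (Cmod_sqr_continuous (fun w => w) u _ (is_Cderive_id u) (e / 2 / eps))
        as [d2 [Hd2 H2]]; [apply Rdiv_lt_0_compat; lra |].
      exists (Rmin d1 d2). split; [apply Rmin_glb_lt; assumption |].
      intros w Hw.
      specialize (H1 w (Rlt_le_trans _ _ _ Hw (Rmin_l _ _))).
      specialize (H2 w (Rlt_le_trans _ _ _ Hw (Rmin_r _ _))).
      apply Rmult_lt_compat_l with (r := eps) in H2; [| exact Heps].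
      replace (eps * (e / 2 / eps)) with (e / 2) in H2 by (field; lra).
      replace (Cmod (F w) ^ 2 + eps * Cmod w ^ 2 - (Cmod (F u) ^ 2 + eps * Cmod u ^ 2))
        with ((Cmod (F w) ^ 2 - Cmod (F u) ^ 2) + eps * (Cmod w ^ 2 - Cmod u ^ 2)) by ring.
      eapply Rle_lt_trans; [apply Rabs_triang |].
      rewrite Rabs_mult, (Rabs_pos_eq eps) by lra. lra. }
    destruct (Rle_lt_or_eq_dec _ _ Hz0) as [Hlt | Heq].
    - exfalso.
      assert (Hin : forall w, Cmod (w - z0)%C < rho - Cmod z0 -> Cmod w <= rho).
      { intros w Hw. generalize (Cmod_sub_le w z0). lra. }
      apply (no_interior_max F F1 z0 (F2 z0) eps (rho - Cmod z0)); auto; lra.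
    - specialize (Hmax z Hz). simpl in Hmax. rewrite Heq in Hmax.
      assert (Cmod (F z0) ^ 2 <= B ^ 2)
        by (apply pow_incr; split; [apply Cmod_ge_0 | apply Hbd, Heq]).
      assert (eps * rho ^ 2 <= eps0).
      { unfold eps. apply Rmult_le_reg_r with (rho ^ 2 + 1); [exact Hr1 |].
        replace (eps0 / (rho ^ 2 + 1) * rho ^ 2 * (rho ^ 2 + 1))
          with (eps0 * rho ^ 2) by (field; lra). nra. }
      generalize (pow2_ge_0 (Cmod z)). intros. simpl in *. nra. }
  apply Rsqr_incr_0_var; [| exact HB].
  unfold Rsqr. simpl in Hsq. lra.
Qed.

(** * Schwarz's lemma *)

Lemma power_series_shift (c : nat -> C) (u : C -> C) :
  power_series_on_disc c u -> c 0%nat = 0 ->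
  exists v, power_series_on_disc (fun k => c (S k)) v /\
    forall z, unit_disc z -> u z = (z * v z)%C.
Proof.
  intros Hu H0.
  (* The quotient [u z / z] is completed at the origin by the constant term of the shifted
     series. *)
  exists (fun z => if Ceq_dec z 0 then c 1%nat else (u z / z)%C).
  split; intros z Hz; cbv beta; destruct (Ceq_dec z 0) as [-> | Hz0].
  - apply is_Cseries_at_0.
  - apply (is_series_ext (K := C_AbsRing) (V := C_NormedModule))
      with (fun k => scal (/ z)%C (c (S k) * z ^ S k)%C).
    + intros k. rewrite Cpow_S. unfold scal; simpl; unfold mult; simpl.
      match goal with |- ?a = ?b => change (@eq C a b) end. field. exact Hz0.
    + eapply is_Cseries_eq.
      * apply (is_series_scal (K := C_AbsRing) (V := C_NormedModule)).
        apply (is_series_incr_1 (K := C_AbsRing) (V := C_NormedModule)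
          (fun k => c k * z ^ k)%C).
        eapply is_Cseries_eq; [apply Hu, Hz |].
        rewrite H0. instantiate (1 := u z). ring_C.
      * change ((/ z * u z)%C = (u z / z)%C). unfold Cdiv. ring.
  - rewrite (power_series_0 c u Hu), H0. ring.
  - field. exact Hz0.
Qed.

(* Applies the maximum principle to [P / Q], which extends [omega / z] for
   [omega = z P / Q] across the origin. *)
Lemma Schwarz_dominated (cP cQ : nat -> C) (P Q : C -> C) :
  power_series_on_disc cP P -> power_series_on_disc cQ Q ->
  (forall z, unit_disc z -> Cmod (z * P z)%C < Cmod (Q z)) ->
  forall z, unit_disc z -> Cmod (P z) <= Cmod (Q z).
Proof.
  intros HP HQ Hlt.
  destruct (power_series_C_derive _ _ HP) as [HP1 HdP].
  destruct (power_series_C_derive _ _ HQ) as [HQ1 HdQ].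
  destruct (power_series_C_derive _ _ HP1) as [_ HdP1].
  destruct (power_series_C_derive _ _ HQ1) as [_ HdQ1].
  assert (HQpos : forall z, unit_disc z -> 0 < Cmod (Q z)).
  { intros z Hz. eapply Rle_lt_trans; [apply Cmod_ge_0 | apply Hlt, Hz]. }
  assert (HQ0 : forall z, unit_disc z -> Q z <> 0)
    by (intros; apply Cmod_pos_neq, HQpos; assumption).
  set (F := fun z => (P z / Q z)%C).
  set (F1 := fun z => ((C_derive P z * Q z - P z * C_derive Q z) / (Q z * Q z))%C).
  assert (HF : forall z, unit_disc z -> is_Cderive F z (F1 z)).
  { intros z Hz. apply is_Cderive_div; auto. }
  assert (HF1 : forall z, unit_disc z -> is_Cderive F1 z (C_derive F1 z)).
  { intros z Hz. apply is_Cderive_C_derive. eexists.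
    apply is_Cderive_div.
    - apply is_Cderive_minus; apply is_Cderive_mult; auto.
    - apply is_Cderive_mult; auto.
    - apply Cmult_neq_0; auto. }
  intros z Hz.
  assert (HFz : Cmod (F z) <= 1).
  { apply le_epsilon. intros eps Heps.
    (* On [|w| = rho] the hypothesis gives [|P / Q| <= / rho]. The first argument keeps [z] inside
       the circle, the second makes [/ rho <= 1 + eps]. *)
    set (rho := Rmax ((1 + Cmod z) / 2) (/ (1 + eps))).
    assert (Hr : Cmod z <= rho /\ 0 < rho < 1 /\ / rho <= 1 + eps).
    { unfold unit_disc in Hz. generalize (Cmod_ge_0 z). intros Hz0.
      assert (He : 0 < / (1 + eps) < 1).
      { split; [apply Rinv_0_lt_compat; lra |].
        rewrite <- Rinv_1. apply Rinv_lt_contravar; lra. }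
      generalize (Rmax_l ((1 + Cmod z) / 2) (/ (1 + eps)))
        (Rmax_r ((1 + Cmod z) / 2) (/ (1 + eps))). fold rho. intros.
      split; [lra |]. split; [split; [lra |]; apply Rmax_lub_lt; lra |].
      apply Rle_trans with (/ / (1 + eps)).
      - apply Rinv_le_contravar; lra.
      - rewrite Rinv_inv. lra. }
    destruct Hr as [Hzr [Hr Hinv]].
    apply Rle_trans with (/ rho); [| exact Hinv].
    assert (Hin : forall w, Cmod w <= rho -> unit_disc w)
      by (unfold unit_disc; intros; lra).
    apply maximum_modulus with F1 (C_derive F1) rho; auto; [lra | |].
    { apply Rlt_le, Rinv_0_lt_compat, Hr. }
    intros w Hw.
    assert (Hwd : unit_disc w) by (apply Hin; lra).
    unfold F. rewrite Cmod_div by auto.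
    specialize (Hlt w Hwd). specialize (HQpos w Hwd).
    rewrite Cmod_mult, Hw in Hlt.
    apply Rmult_le_reg_r with (rho * Cmod (Q w)); [apply Rmult_lt_0_compat; lra |].
    replace (Cmod (P w) / Cmod (Q w) * (rho * Cmod (Q w)))
      with (rho * Cmod (P w)) by (field; lra).
    replace (/ rho * (rho * Cmod (Q w))) with (Cmod (Q w)) by (field; lra). lra. }
  unfold F in HFz. rewrite Cmod_div in HFz by auto. specialize (HQpos z Hz).
  apply Rmult_le_compat_r with (r := Cmod (Q z)) in HFz; [| lra].
  replace (Cmod (P z) / Cmod (Q z) * Cmod (Q z)) with (Cmod (P z)) in HFz
    by (field; lra). lra.
Qed.

(** * Koebe transforms *)

Definition disc_automorphism (a z : C) : C := ((z + a) / (1 + Cconj a * z))%C.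

Lemma disc_automorphism_den (a z : C) :
  unit_disc a -> unit_disc z -> (1 + Cconj a * z)%C <> 0.
Proof.
  unfold unit_disc. intros Ha Hz. apply Cmod_pos_neq.
  generalize (Cmod_sub_le 1 (- (Cconj a * z))).
  replace (1 - - (Cconj a * z))%C with (1 + Cconj a * z)%C by ring.
  rewrite Cmod_opp, Cmod_mult, Cmod_conj, Cmod_1.
  generalize (Cmod_ge_0 a) (Cmod_ge_0 z). nra.
Qed.

Lemma disc_automorphism_in (a z : C) :
  unit_disc a -> unit_disc z -> unit_disc (disc_automorphism a z).
Proof.
  intros Ha Hz. assert (Hden := disc_automorphism_den a z Ha Hz).
  unfold unit_disc, disc_automorphism in *.
  rewrite Cmod_div by exact Hden.
  apply Cmod_gt_0 in Hden.
  assert (E : Cmod (1 + Cconj a * z)%C ^ 2 - Cmod (z + a)%C ^ 2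
    = (1 - Cmod a ^ 2) * (1 - Cmod z ^ 2)).
  { rewrite !Cmod_sqr. destruct a, z; simpl; ring. }
  generalize (Cmod_ge_0 a) (Cmod_ge_0 z) (Cmod_ge_0 (z + a)). intros.
  assert (0 < (1 - Cmod a ^ 2) * (1 - Cmod z ^ 2))
    by (apply Rmult_lt_0_compat; nra).
  apply Rmult_lt_reg_r with (Cmod (1 + Cconj a * z)%C); [exact Hden |].
  unfold Rdiv. rewrite Rmult_assoc, Rinv_l by lra. nra.
Qed.

Lemma is_Cderive_disc_automorphism (a z : C) :
  unit_disc a -> unit_disc z ->
  is_Cderive (disc_automorphism a) z
    (RtoC (1 - Cmod a ^ 2) / ((1 + Cconj a * z) * (1 + Cconj a * z)))%C.
Proof.
  intros Ha Hz. eapply is_Cderive_eq.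
  - apply is_Cderive_div; [| | apply disc_automorphism_den; assumption].
    + apply is_Cderive_plus; [apply is_Cderive_id | apply is_Cderive_const].
    + apply is_Cderive_plus; [apply is_Cderive_const |].
      apply is_Cderive_scal, is_Cderive_id.
  - cbv beta. rewrite RtoC_minus, Cmod2_conj. f_equal. ring.
Qed.

Lemma unit_disc_0 : unit_disc 0.
Proof. unfold unit_disc. rewrite Cmod_0. lra. Qed.

(** The Koebe transform at [a] has analytic part [koebe_component h a c] with
    [c = (1 - |a|^2) h'(a)], and co-analytic part [koebe_component g a (Cconj c)]: dividing
    [Cconj g] by [c] divides [g] by [Cconj c]. *)
Definition koebe_component (u : C -> C) (a c z : C) : C :=
  (/ c * (u (disc_automorphism a z) - u a))%C.

Lemma is_Cderive_koebe_component (u u1 : C -> C) (a c z : C) :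
  (forall w, unit_disc w -> is_Cderive u w (u1 w)) ->
  unit_disc a -> unit_disc z ->
  is_Cderive (koebe_component u a c) z
    (/ c * (u1 (disc_automorphism a z) *
      (RtoC (1 - Cmod a ^ 2) / ((1 + Cconj a * z) * (1 + Cconj a * z)))))%C.
Proof.
  intros Hu Ha Hz. apply is_Cderive_scal.
  eapply is_Cderive_eq.
  - apply is_Cderive_minus; [| apply is_Cderive_const].
    apply is_Cderive_comp; [| apply is_Cderive_disc_automorphism; assumption].
    apply Hu, disc_automorphism_in; assumption.
  - cbv beta. ring.
Qed.

Lemma disc_automorphism_0 (a : C) : disc_automorphism a 0 = a.
Proof.
  unfold disc_automorphism. replace (1 + Cconj a * 0)%C with (RtoC 1) by ring.
  field.
Qed.

Lemma koebe_component_taylor (u u1 : C -> C) (u2 a c : C) :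
  (forall w, unit_disc w -> is_Cderive u w (u1 w)) ->
  is_Cderive u1 a u2 -> unit_disc a -> c <> 0 ->
  taylor_coef (koebe_component u a c) 1 = (u1 a * RtoC (1 - Cmod a ^ 2) / c)%C /\
  taylor_coef (koebe_component u a c) 2 =
    (RtoC (1 - Cmod a ^ 2) * (RtoC (1 - Cmod a ^ 2) * u2 - 2 * Cconj a * u1 a)
     / (2 * c))%C.
Proof.
  intros Hu Hu1 Ha Hc.
  set (s := RtoC (1 - Cmod a ^ 2)).
  set (v := fun z => (/ c * (u1 (disc_automorphism a z) *
      (s / ((1 + Cconj a * z) * (1 + Cconj a * z)))))%C).
  assert (Hv : forall z, unit_disc z -> is_Cderive (koebe_component u a c) z (v z))
    by (intros; apply is_Cderive_koebe_component; assumption).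
  assert (Ev : forall z, unit_disc z -> C_derive (koebe_component u a c) z = v z)
    by (intros; apply is_C_derive_unique, Hv; assumption).
  assert (N1 : RtoC 1 <> 0) by (intros H; injection H; lra).
  assert (N2 : RtoC 2 <> 0) by (intros H; injection H; lra).
  assert (E0 : (1 + Cconj a * 0)%C = 1) by ring.
  assert (Hd : is_Cderive (disc_automorphism a) (RtoC 0) (s / (1 * 1))%C).
  { eapply is_Cderive_eq; [apply is_Cderive_disc_automorphism; auto using unit_disc_0 |].
    rewrite E0. reflexivity. }
  assert (Hv2 : is_Cderive v (RtoC 0) (s * (s * u2 - 2 * Cconj a * u1 a) / c)%C).
  { eapply is_Cderive_eq.
    - apply is_Cderive_scal, is_Cderive_mult.
      + apply is_Cderive_comp; [rewrite disc_automorphism_0; exact Hu1 | exact Hd].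
      + apply is_Cderive_div; [apply is_Cderive_const | |].
        * apply is_Cderive_mult; (apply is_Cderive_plus; [apply is_Cderive_const |];
            apply is_Cderive_scal, is_Cderive_id).
        * rewrite E0. intros H. apply N1. rewrite <- H. ring.
    - cbv beta. rewrite disc_automorphism_0, E0. field. auto. }
  assert (Hv2' : C_derive (C_derive (koebe_component u a c)) 0
    = (s * (s * u2 - 2 * Cconj a * u1 a) / c)%C).
  (* The second derivative is that of the function [C_derive _], known to equal [v] only inside the
     disc; agreement near 0 is enough. *)
  { apply is_C_derive_unique.
    apply is_Cderive_ext_disc with v; [apply unit_disc_0 | | exact Hv2].
    intros w Hw. symmetry. apply Ev, Hw. }
  unfold taylor_coef. split.
  - change (Nat.iter 1 C_derive (koebe_component u a c) 0)
      with (C_derive (koebe_component u a c) 0).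
    rewrite Ev by apply unit_disc_0. unfold v.
    rewrite disc_automorphism_0, E0. simpl. field. auto.
  - change (Nat.iter 2 C_derive (koebe_component u a c) 0)
      with (C_derive (C_derive (koebe_component u a c)) 0).
    rewrite Hv2'. replace (INR (fact 2)) with 2 by (simpl; ring). field. auto.
Qed.

(** With [p = h'(a)], [q = g'(a)] and [J = |p|^2 - |q|^2], the Koebe transform has
    [b1 = q / Cconj p], so [1 - |b1|^2 = J / |p|^2], and [a2 - Cconj b1 * b2 = X / (2 |p|^2)] where
    [X] is the expression inside the modulus. The order quotient is therefore [|X| / (2 J)]. *)
Lemma strong_order_inequality (Fam : (C -> C) -> Prop) (alpha : R)
  (f h g : C -> C) (a h2 g2 : C) :
  linear_invariant Fam -> Rbar_le (ord_bar Fam) alpha ->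
  Fam f -> canonical_decomposition f h g -> unit_disc a ->
  is_Cderive (C_derive h) a h2 -> is_Cderive (C_derive g) a g2 ->
  Cmod (C_derive g a) < Cmod (C_derive h a) ->
  Cmod (RtoC (1 - Cmod a ^ 2) *
          (h2 * Cconj (C_derive h a) - g2 * Cconj (C_derive g a))
        - 2 * Cconj a * RtoC (Cmod (C_derive h a) ^ 2 - Cmod (C_derive g a) ^ 2))%C
  <= 2 * alpha * (Cmod (C_derive h a) ^ 2 - Cmod (C_derive g a) ^ 2).
Proof.
  intros Hlin Hord Hf [Hh Hg Hg0 Heq] Ha Hh2 Hg2 Hlt.
  set (s := 1 - Cmod a ^ 2). set (p := C_derive h a) in *. set (q := C_derive g a) in *.
  assert (Hs : 0 < s).
  { unfold s, unit_disc in *. generalize (Cmod_ge_0 a). nra. }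
  assert (Hp : 0 < Cmod p) by (eapply Rle_lt_trans; [apply Cmod_ge_0 | exact Hlt]).
  assert (Hp0 : p <> 0) by (apply Cmod_pos_neq, Hp).
  assert (Hs0 : RtoC s <> 0) by (intros E; injection E; lra).
  assert (Hcp0 : Cconj p <> 0)
    by (apply Cmod_pos_neq; rewrite Cmod_conj; exact Hp).
  set (c := (RtoC s * p)%C).
  assert (Hc : c <> 0) by (apply Cmult_neq_0; assumption).
  assert (Ecc : Cconj c = (RtoC s * Cconj p)%C).
  { unfold c. rewrite Cmult_conj. f_equal. unfold Cconj, RtoC; simpl. f_equal. ring. }
  assert (Hcc : Cconj c <> 0) by (rewrite Ecc; apply Cmult_neq_0; assumption).
  set (K := fun z : C =>
      ((f (cis 0 * ((z + a) / (1 + Cconj a * z))) - f (a * cis 0)) /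
      ((1 - Cmod a ^ 2) * C_derive h (a * cis 0) * cis 0))%C).
  assert (HK : Fam K).
  { apply (lif_koebe Fam Hlin f h g); [exact Hf | split; assumption | exact Ha]. }
  assert (dh : forall w, unit_disc w -> is_Cderive h w (C_derive h w))
    by (intros; apply is_Cderive_C_derive, Hh; assumption).
  assert (dg : forall w, unit_disc w -> is_Cderive g w (C_derive g w))
    by (intros; apply is_Cderive_C_derive, Hg; assumption).
  assert (HKd : canonical_decomposition K
    (koebe_component h a c) (koebe_component g a (Cconj c))).
  { split.
    - intros z Hz. eexists. apply is_Cderive_koebe_component; eassumption.
    - intros z Hz. eexists. apply is_Cderive_koebe_component; eassumption.
    - unfold koebe_component. rewrite disc_automorphism_0. ring.
    - intros z Hz. unfold K. rewrite cis_0, Cmult_1_l, !Cmult_1_r. fold p.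
      change ((z + a) / (1 + Cconj a * z))%C with (disc_automorphism a z).
      rewrite (Heq _ (disc_automorphism_in a z Ha Hz)), (Heq a Ha).
      unfold koebe_component.
      rewrite Cmult_conj, Cminus_conj, Cinv_conj, Cconj_conj by exact Hcc.
      replace ((1 - Cmod a ^ 2) * p)%C with c; [field; exact Hc |].
      unfold c, s. rewrite RtoC_minus, RtoC_pow. reflexivity. }
  assert (Hle : Cmod (taylor_coef (koebe_component h a c) 2 -
      Cconj (taylor_coef (koebe_component g a (Cconj c)) 1) *
      taylor_coef (koebe_component g a (Cconj c)) 2)%C /
      (1 - Cmod (taylor_coef (koebe_component g a (Cconj c)) 1) ^ 2) <= alpha).
  { change (Rbar_le (Cmod (taylor_coef (koebe_component h a c) 2 -
      Cconj (taylor_coef (koebe_component g a (Cconj c)) 1) *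
      taylor_coef (koebe_component g a (Cconj c)) 2)%C /
      (1 - Cmod (taylor_coef (koebe_component g a (Cconj c)) 1) ^ 2)) alpha).
    eapply Rbar_le_trans; [| exact Hord].
    apply (proj1 (Lub_Rbar_correct _)).
    exists K, (koebe_component h a c), (koebe_component g a (Cconj c)). auto. }
  destruct (koebe_component_taylor h _ h2 a c dh Hh2 Ha Hc) as [_ E2].
  destruct (koebe_component_taylor g _ g2 a (Cconj c) dg Hg2 Ha Hcc) as [E1' E2'].
  rewrite E2, E1', E2', Ecc in Hle. fold s p q in Hle.
  assert (N2 : RtoC 2 <> 0) by (intros H; injection H; lra).
  set (J := Cmod p ^ 2 - Cmod q ^ 2) in *.
  assert (HJ : 0 < J) by (unfold J; generalize (Cmod_ge_0 q); nra).
  set (X := (RtoC s * (h2 * Cconj p - g2 * Cconj q) - 2 * Cconj a * RtoC J)%C).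
  assert (EB : (q * RtoC s / (RtoC s * Cconj p))%C = (q / Cconj p)%C)
    by (field; auto).
  rewrite EB in Hle.
  assert (EX : (RtoC s * (RtoC s * h2 - 2 * Cconj a * p) / (2 * c)
    - Cconj (q / Cconj p) *
      (RtoC s * (RtoC s * g2 - 2 * Cconj a * q) / (2 * (RtoC s * Cconj p))))%C
    = (X / (2 * (p * Cconj p)))%C).
  { rewrite Cdiv_conj, Cconj_conj by exact Hcp0.
    unfold X, J, c. rewrite RtoC_minus, !Cmod2_conj. field. auto. }
  rewrite EX, <- Cmod2_conj in Hle.
  rewrite !Cmod_div, Cmod_conj, Cmod_mult, !Cmod_R in Hle; auto.
  - rewrite !Rabs_pos_eq in Hle by (try apply pow2_ge_0; lra).
    replace (Cmod X / (2 * Cmod p ^ 2) / (1 - (Cmod q / Cmod p) ^ 2))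
      with (Cmod X / (2 * J)) in Hle.
    + apply Rmult_le_compat_r with (r := 2 * J) in Hle; [| lra].
      replace (Cmod X / (2 * J) * (2 * J)) with (Cmod X) in Hle by (field; lra).
      lra.
    + unfold J. field. fold J. 
      repeat split; apply Rgt_not_eq; try lra; try (unfold J in HJ; nra).
  - rewrite Cmod2_conj. repeat apply Cmult_neq_0; auto.
Qed.

(** * Distortion of the Jacobian *)

Definition jacobian (h g : C -> C) (z : C) : R :=
  Cmod (C_derive h z) ^ 2 - Cmod (C_derive g z) ^ 2.

(** Carries positivity of the Jacobian from the decomposition supplied by the family to the one
    whose coefficients are estimated. *)
Lemma canonical_decomposition_derive_unique (f h g h' g' : C -> C) (z : C) :
  canonical_decomposition f h g -> canonical_decomposition f h' g' ->
  unit_disc z -> C_derive h z = C_derive h' z /\ C_derive g z = C_derive g' z.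
Proof.
  intros [Hh Hg _ Heq] [Hh' Hg' _ Heq'] Hz.
  set (p := C_derive h z). set (q := C_derive g z).
  set (p' := C_derive h' z). set (q' := C_derive g' z).
  assert (Hu : is_Cderive (fun w => h w - h' w)%C z (p - p')%C)
    by (apply is_Cderive_minus; apply is_Cderive_C_derive; auto).
  assert (Hv : is_Cderive (fun w => g' w - g w)%C z (q' - q)%C)
    by (apply is_Cderive_minus; apply is_Cderive_C_derive; auto).
  assert (E : forall w, unit_disc w -> (h w - h' w)%C = Cconj (g' w - g w)%C).
  { intros w Hw. rewrite Cminus_conj.
    generalize (Heq w Hw) (Heq' w Hw). intros -> H.
    replace (h w) with (h w + Cconj (g w) - Cconj (g w))%C by ring.
    rewrite H. ring. }
  (* [h - h'] and its conjugate are both complex differentiable, so their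
     derivatives in the directions [1] and [i] force both to vanish. *)
  assert (Hd : forall d : C, Cmod d = 1 -> ((p - p') * d)%C = Cconj ((q' - q) * d)%C).
  { intros d Hdd.
    assert (Ez : z = (z + RtoC 0 * d)%C) by ring.
    rewrite Ez in Hu, Hv at 1.
    apply is_derive_Cderive_line in Hu. apply is_derive_Cderive_line in Hv.
    destruct Hu as [Hu1 Hu2]. destruct Hv as [Hv1 Hv2].
    assert (Hloc : locally (T := R_UniformSpace) 0 (fun t : R => unit_disc (z + t * d)%C)).
    { unfold unit_disc in *. exists (mkposreal (1 - Cmod z) ltac:(lra)).
      intros t Ht. change (Rabs (t - 0) < 1 - Cmod z) in Ht.
      rewrite Rminus_0_r in Ht.
      eapply Rle_lt_trans; [apply Cmod_triangle |].
      rewrite Cmod_mult, Cmod_R, Hdd. lra. }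
    assert (H1 : Re ((p - p') * d)%C = Re ((q' - q) * d)%C).
    { rewrite <- (is_derive_unique _ _ _ Hu1), <- (is_derive_unique _ _ _ Hv1).
      apply Derive_ext_loc. revert Hloc. apply filter_imp.
      intros t Ht. rewrite (E _ Ht). apply re_conj. }
    assert (H2 : Im ((p - p') * d)%C = - Im ((q' - q) * d)%C).
    { rewrite <- (is_derive_unique _ _ _ Hu2), <- (is_derive_unique _ _ _ Hv2).
      rewrite <- Derive_opp.
      apply Derive_ext_loc. revert Hloc. apply filter_imp.
      intros t Ht. rewrite (E _ Ht). apply im_conj. }
    revert H1 H2. generalize ((p - p') * d)%C ((q' - q) * d)%C.
    intros [x y] [x' y'] H1 H2. unfold Cconj. simpl in *. congruence. }
  generalize (Hd 1 Cmod_1) (Hd Ci Cmod_Ci). clearbody p p' q q'.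
  destruct p as [x y], p' as [x' y'], q as [u v], q' as [u' v'].
  unfold Cconj; simpl. intros H1 H2. injection H1. injection H2. intros.
  split; f_equal; lra.
Qed.

Lemma is_derive_jacobian_line (h g : C -> C) (e h2 g2 : C) (t : R) :
  is_Cderive (C_derive h) (t * e)%C h2 -> is_Cderive (C_derive g) (t * e)%C g2 ->
  is_derive (fun s : R => jacobian h g (s * e)%C) t
    (2 * Re ((h2 * Cconj (C_derive h (t * e)) - g2 * Cconj (C_derive g (t * e))) * e)%C).
Proof.
  intros Hh Hg.
  assert (E0 : forall s : R, (0 + s * e)%C = (s * e)%C) by (intros; ring).
  rewrite <- E0 in Hh, Hg.
  apply is_derive_Cmod_sqr_line in Hh. apply is_derive_Cmod_sqr_line in Hg.
  generalize (is_derive_minus (K := R_AbsRing) (V := R_NormedModule) _ _ _ _ _ Hh Hg).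
  intros H.
  apply (is_derive_ext (K := R_AbsRing) (V := R_NormedModule) _
    (fun s : R => jacobian h g (s * e)%C)) in H.
  - match goal with |- is_derive _ _ ?x => match type of H with
      is_derive _ _ ?y => replace x with y; [exact H |] end end.
    rewrite !E0. destruct (C_derive h (t * e)), (C_derive g (t * e)), h2, g2, e.
    unfold minus, plus, opp; simpl. ring.
  - intros s. unfold jacobian. rewrite E0. reflexivity.
Qed.

(** Written as the logarithmic derivative times the function, the shape in which an integrating
    factor meets a linear differential inequality. *)
Lemma is_derive_pow_quotient (m n : nat) (t : R) :
  1 - t <> 0 -> 1 + t <> 0 ->
  is_derive (fun s : R => (1 - s) ^ S m * / (1 + s) ^ S n) t
    (- (INR (S m) * (1 + t) + INR (S n) * (1 - t)) / ((1 - t) * (1 + t))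
     * ((1 - t) ^ S m * / (1 + t) ^ S n)).
Proof.
  intros H1 H2. assert (H3 : (1 + t) ^ n <> 0) by (apply pow_nonzero, H2).
  auto_derive.
  - apply Rmult_integral_contrapositive_currified; assumption.
  - rewrite <- !tech_pow_Rmult. simpl pred.
    change (match m with 0%nat => 1 | S _ => INR m + 1 end) with (INR (S m)).
    change (match n with 0%nat => 1 | S _ => INR n + 1 end) with (INR (S n)).
    change (1 + - t) with (1 - t). field. auto.
Qed.

Lemma jacobian_upper_bound (h g : C -> C) (z : C) :
  (forall w, unit_disc w -> ex_derive (K := C_AbsRing) (V := C_NormedModule) (C_derive h) w) ->
  (forall w, unit_disc w -> ex_derive (K := C_AbsRing) (V := C_NormedModule) (C_derive g) w) ->
  jacobian h g 0 = 1 ->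
  (forall w h2 g2, unit_disc w ->
    is_Cderive (C_derive h) w h2 -> is_Cderive (C_derive g) w g2 ->
    Cmod (RtoC (1 - Cmod w ^ 2) *
          (h2 * Cconj (C_derive h w) - g2 * Cconj (C_derive g w))
        - 2 * Cconj w * RtoC (jacobian h g w))%C <= 33 * jacobian h g w) ->
  unit_disc z ->
  jacobian h g z * (1 - Cmod z) ^ 35 <= (1 + Cmod z) ^ 31.
Proof.
  intros Hh Hg HJ0 Hineq Hz. unfold unit_disc in Hz.
  destruct (Ceq_dec z 0) as [-> | Hz0].
  { rewrite HJ0, Cmod_0, Rminus_0_r, Rplus_0_r, !pow1. lra. }
  set (r := Cmod z) in *.
  assert (Hr : 0 < r) by (apply Cmod_gt_0, Hz0).
  set (e := (z / r)%C).
  assert (Hr0 : RtoC r <> 0) by (intros E; injection E; lra).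
  assert (He : Cmod e = 1).
  { unfold e. rewrite Cmod_div, Cmod_R, Rabs_pos_eq by (auto; lra).
    fold r. field. lra. }
  assert (Ez : z = (r * e)%C) by (unfold e; field; exact Hr0).
  assert (Hin : forall t, 0 <= t <= r -> unit_disc (t * e)%C).
  { intros t Ht. unfold unit_disc. rewrite Cmod_mult, He, Cmod_R, Rabs_pos_eq; lra. }
  set (J := fun t : R => jacobian h g (t * e)%C).
  assert (HdJ : forall t, 0 <= t <= r -> exists dJ, is_derive J t dJ /\
    dJ * ((1 - t) * (1 + t)) <= (66 + 4 * t) * J t).
  { intros t Ht.
    destruct (Hh _ (Hin t Ht)) as [h2 Hh2]. destruct (Hg _ (Hin t Ht)) as [g2 Hg2].
    eexists. split; [apply is_derive_jacobian_line; eassumption |].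
    specialize (Hineq _ h2 g2 (Hin t Ht) Hh2 Hg2).
    set (D := (h2 * Cconj (C_derive h (t * e)) - g2 * Cconj (C_derive g (t * e)))%C) in *.
    fold (J t) in Hineq.
    assert (Hct : Cmod (t * e)%C = t)
      by (rewrite Cmod_mult, He, Cmod_R, Rabs_pos_eq; lra).
    rewrite Hct in Hineq.
    set (Y := (RtoC (1 - t ^ 2) * D - 2 * Cconj (t * e) * RtoC (J t))%C) in *.
    assert (HY : Re (Y * e)%C <= 33 * J t).
    { eapply Rle_trans; [apply Rle_abs |].
      eapply Rle_trans; [apply re_le_Cmod |].
      rewrite Cmod_mult, He, Rmult_1_r. exact Hineq. }
    (* Multiplying by the direction [e] turns [Cconj (t e)] into the real number [t], and the real
       part of [D e] is half the radial derivative of [J]. The outcome is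
       [(1 - t^2) J' <= (66 + 4 t) J]. *)
    assert (EY : (Y * e)%C
      = (RtoC (1 - t ^ 2) * (D * e) - RtoC (2 * t * J t))%C).
    { assert (Ee : (Cconj e * e)%C = 1).
      { rewrite Cmult_comm, <- Cmod2_conj, He. f_equal. ring. }
      unfold Y. rewrite Cmult_conj, !RtoC_mult.
      replace (Cconj (RtoC t)) with (RtoC t)
        by (unfold Cconj, RtoC; simpl; f_equal; ring).
      transitivity (RtoC (1 - t ^ 2) * (D * e) - 2 * t * J t * (Cconj e * e))%C; [ring |].
      rewrite Ee. ring. }
    rewrite EY in HY.
    assert (ER : Re (RtoC (1 - t ^ 2) * (D * e) - RtoC (2 * t * J t))%C
      = (1 - t ^ 2) * Re (D * e)%C - 2 * t * J t).
    { destruct (D * e)%C. simpl. ring. }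
    rewrite ER in HY. nra. }
  (* The integrating factor: [35 (1 + t) + 31 (1 - t) = 66 + 4 t], with [35 = 2 alpha + 2] and
     [31 = 2 alpha - 2]. Hence [J w] does not increase along the radius. *)
  set (w := fun t : R => (1 - t) ^ 35 * / (1 + t) ^ 31).
  assert (Hw : forall t, 0 <= t <= r ->
    is_derive w t (- (66 + 4 * t) / ((1 - t) * (1 + t)) * w t)).
  { intros t Ht.
    assert (H := is_derive_pow_quotient 34 30 t ltac:(lra) ltac:(lra)).
    match goal with |- is_derive _ _ ?x => match type of H with
      is_derive _ _ ?y => replace x with y; [exact H |] end end.
    unfold w. simpl INR. unfold Rdiv. ring. }
  assert (Hdec : J r * w r <= J 0 * w 0).
  { set (dJ := fun t => Derive J t).
    destruct (MVT_cor2 (fun t => J t * w t)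
      (fun t => dJ t * w t + J t * (- (66 + 4 * t) / ((1 - t) * (1 + t)) * w t)) 0 r)
      as [t [E Ht]]; [exact Hr | |].
    - intros t Ht. apply is_derive_Reals.
      apply (is_derive_mult (K := R_AbsRing) J w); [| apply Hw, Ht | apply Rmult_comm].
      destruct (HdJ t Ht) as [l [Hl _]]. unfold dJ.
      rewrite (is_derive_unique _ _ _ Hl). exact Hl.
    - destruct (HdJ t ltac:(lra)) as [l [Hl Hle]].
      unfold dJ in E. rewrite (is_derive_unique _ _ _ Hl) in E.
      assert (Hpos : 0 < (1 - t) * (1 + t)) by nra.
      assert (Hwt : 0 < w t).
      { apply Rmult_lt_0_compat; [| apply Rinv_0_lt_compat]; apply pow_lt; lra. }
      assert (l * w t + J t * (- (66 + 4 * t) / ((1 - t) * (1 + t)) * w t)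
        = (l * ((1 - t) * (1 + t)) - (66 + 4 * t) * J t) / ((1 - t) * (1 + t)) * w t)
        as E' by (field; lra).
      rewrite E' in E.
      assert (0 <= - ((l * ((1 - t) * (1 + t)) - (66 + 4 * t) * J t)
        / ((1 - t) * (1 + t)))).
      { unfold Rdiv. rewrite Ropp_mult_distr_l. apply Rmult_le_pos; [lra |].
        apply Rlt_le, Rinv_0_lt_compat, Hpos. }
      assert (0 <= w t * (r - 0)) by (apply Rmult_le_pos; lra).
      rewrite Rmult_assoc in E. nra. }
  assert (EJ0 : J 0 * w 0 = 1).
  { unfold J, w. replace (RtoC 0 * e)%C with (RtoC 0) by ring.
    rewrite HJ0, Rminus_0_r, Rplus_0_r, !pow1. field. }
  rewrite EJ0 in Hdec. rewrite Ez. fold (J r).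
  assert (Hr1 : 0 < (1 + r) ^ 31) by (apply pow_lt; lra).
  apply Rmult_le_compat_r with (r := (1 + r) ^ 31) in Hdec; [| lra].
  replace (J r * w r * (1 + r) ^ 31) with (J r * (1 - r) ^ 35) in Hdec
    by (unfold w; field; lra).
  lra.
Qed.

(** * Coefficient bounds *)

Lemma is_Cseries_conj (a : nat -> C) (l : C) :
  is_Cseries a l -> is_Cseries (fun k => Cconj (a k)) (Cconj l).
Proof.
  intros H.
  apply (filterlim_ext (fun n => Cconj (sum_n (G := C_AbelianMonoid) a n))).
  - induction x as [| n IH]; [rewrite !sum_O; reflexivity |].
    rewrite !sum_Sn, <- IH. apply Cplus_conj.
  - apply (filterlim_locally_ball_norm (K := C_AbsRing) (U := C_NormedModule)).
    intros eps.
    generalize (proj1 (filterlim_locally_ball_norm (K := C_AbsRing)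
      (U := C_NormedModule) _ _) H eps).
    apply filter_imp. intros n Hn.
    change (Cmod (Cconj (sum_n (G := C_AbelianMonoid) a n) - Cconj l)%C < eps).
    rewrite <- Cminus_conj, Cmod_conj. exact Hn.
Qed.

(** Here [k] is [g' / z] completed at 0. Giving it the same bound as [h'] lets one coefficient lemma
    treat both sequences, with the index shifted once more for [g]. *)
Lemma C_derive_distortion (f h g : C -> C) (ch cg : nat -> C) :
  U_H (33 / 2) f -> canonical_decomposition f h g ->
  power_series_on_disc ch h -> power_series_on_disc cg g ->
  ch 1%nat = 1 -> cg 1%nat = 0 ->
  exists k, power_series_on_disc (fun j => derived_coef cg (S j)) k /\
  forall z, unit_disc z ->
    Cmod (C_derive h z) * (1 - Cmod z) ^ 18 <= (1 + Cmod z) ^ 15 /\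
    Cmod (k z) * (1 - Cmod z) ^ 18 <= (1 + Cmod z) ^ 15.
Proof.
  intros [Fam [[Hlin _] [Hord Hf]]] Hd Hh Hg Hch Hcg.
  destruct (power_series_C_derive _ _ Hh) as [Hh1 _].
  destruct (power_series_C_derive _ _ Hg) as [Hg1 _].
  destruct (power_series_C_derive _ _ Hh1) as [_ Hh2].
  destruct (power_series_C_derive _ _ Hg1) as [_ Hg2].
  destruct (lif_mapping Fam Hlin f Hf) as [_ [_ [h0 [g0 [Hd0 [_ HJ0]]]]]].
  assert (HJ : forall z, unit_disc z -> Cmod (C_derive g z) < Cmod (C_derive h z)).
  { intros z Hz.
    destruct (canonical_decomposition_derive_unique _ _ _ _ _ z Hd Hd0 Hz) as [-> ->].
    specialize (HJ0 z Hz).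
    generalize (Cmod_ge_0 (C_derive h0 z)) (Cmod_ge_0 (C_derive g0 z)). nra. }
  assert (N1 : derived_coef ch 0 = 1)
    by (unfold derived_coef; rewrite Hch; simpl; ring).
  assert (N0 : derived_coef cg 0 = 0)
    by (unfold derived_coef; rewrite Hcg; ring).
  destruct (power_series_shift _ _ Hg1 N0) as [k [Hk Ek]].
  exists k. split; [exact Hk |].
  intros z Hz.
  assert (HS : forall w, unit_disc w -> Cmod (k w) <= Cmod (C_derive h w)).
  { apply (Schwarz_dominated _ _ _ _ Hk Hh1).
    intros w Hw. rewrite <- Ek by exact Hw. apply HJ, Hw. }
  assert (Hjac : jacobian h g z * (1 - Cmod z) ^ 35 <= (1 + Cmod z) ^ 31).
  { apply jacobian_upper_bound; [| | | | exact Hz].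
    - intros w Hw. eexists. apply Hh2, Hw.
    - intros w Hw. eexists. apply Hg2, Hw.
    - unfold jacobian.
      rewrite (power_series_0 _ _ Hh1), (power_series_0 _ _ Hg1), N1, N0, Cmod_1, Cmod_0.
      ring.
    - intros w h2 g2 Hw Hh2' Hg2'.
      replace (33 * jacobian h g w) with (2 * (33 / 2) * jacobian h g w) by field.
      unfold jacobian.
      eapply strong_order_inequality; try eassumption. apply HJ, Hw. }
  unfold unit_disc in Hz.
  set (r := Cmod z) in *. set (x := Cmod (C_derive h z)) in *.
  assert (Hr : 0 <= r) by apply Cmod_ge_0.
  assert (Hx : 0 <= x) by apply Cmod_ge_0.
  assert (HJx : x ^ 2 * ((1 - r) * (1 + r)) <= jacobian h g z).
  { unfold jacobian. fold x. rewrite (Ek z Hz), Cmod_mult. fold r.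
    specialize (HS z Hz). fold x in HS.
    assert (Cmod (k z) ^ 2 <= x ^ 2)
      by (apply pow_incr; split; [apply Cmod_ge_0 | exact HS]).
    rewrite Rpow_mult_distr. generalize (pow2_ge_0 r). nra. }
  assert (Hx18 : x * (1 - r) ^ 18 <= (1 + r) ^ 15).
  { apply Rsqr_incr_0_var; [| apply pow_le; lra].
    (* The factor [1 + r] completes the square of the left side to [x^2 (1 - r^2) (1 - r)^35] and
       that of the right side to [(1 + r)^31]. *)
    apply Rmult_le_reg_l with (1 + r); [lra |].
    unfold Rsqr.
    replace ((1 + r) * ((1 + r) ^ 15 * (1 + r) ^ 15)) with ((1 + r) ^ 31) by ring.
    eapply Rle_trans; [| exact Hjac].
    replace ((1 + r) * (x * (1 - r) ^ 18 * (x * (1 - r) ^ 18)))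
      with (x ^ 2 * ((1 - r) * (1 + r)) * (1 - r) ^ 35) by ring.
    apply Rmult_le_compat_r; [apply pow_le; lra | exact HJx]. }
  split; [exact Hx18 |].
  eapply Rle_trans; [| exact Hx18].
  apply Rmult_le_compat_r; [apply pow_le; lra | apply HS, Hz].
Qed.

Lemma Cauchy_estimate_distortion (c : nat -> C) (u : C -> C) (m : nat) (r : R) :
  power_series_on_disc c u ->
  (forall z, unit_disc z -> Cmod (u z) * (1 - Cmod z) ^ 18 <= (1 + Cmod z) ^ 15) ->
  0 < r < 1 ->
  Cmod (c m) * (r ^ m * (1 - r) ^ 18) <= (1 + r) ^ 15.
Proof.
  intros Hu Hb Hr.
  assert (H18 : 0 < (1 - r) ^ 18) by (apply pow_lt; lra).
  assert (H : Cmod (c m) * r ^ m <= (1 + r) ^ 15 / (1 - r) ^ 18).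
  { apply Cauchy_estimate with u; [exact Hu | lra |].
    intros z Hz. specialize (Hb z). unfold unit_disc in Hb. rewrite Hz in Hb.
    apply Rmult_le_reg_r with ((1 - r) ^ 18); [exact H18 |].
    unfold Rdiv. rewrite Rmult_assoc, Rinv_l, Rmult_1_r by lra. apply Hb. lra. }
  apply Rmult_le_compat_r with (r := (1 - r) ^ 18) in H; [| lra].
  unfold Rdiv in H. rewrite (Rmult_assoc _ (/ _)), Rinv_l, Rmult_1_r in H by lra.
  rewrite <- Rmult_assoc. exact H.
Qed.

(** * Choice of the radius in Cauchy's estimate *)

Lemma rational_radius (p q u v N : Z) (m : nat) :
  (0 < q)%Z -> (0 < u < v)%Z ->
  (q * (v + u) ^ 15 * v ^ Z.of_nat (m + 3)
     < p * N ^ 18 * u ^ Z.of_nat m * (v - u) ^ 18)%Z ->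
  exists r, 0 < r < 1 /\
    (1 + r) ^ 15 < IZR p / IZR q * IZR N ^ 18 * (r ^ m * (1 - r) ^ 18).
Proof.
  intros Hq [Hu Hv] H.
  exists (IZR u / IZR v).
  apply IZR_lt in Hq, Hu, Hv, H.
  set (a := IZR u) in *. set (b := IZR v) in *.
  change 15%Z with (Z.of_nat 15) in H. change 18%Z with (Z.of_nat 18) in H.
  rewrite !mult_IZR, <- !pow_IZR, plus_IZR, minus_IZR in H. fold a b in H.
  split.
  - split; [apply Rdiv_lt_0_compat; lra |].
    apply Rmult_lt_reg_r with b; [lra |].
    unfold Rdiv. rewrite Rmult_assoc, Rinv_l; lra.
  - assert (Hbm : 0 < b ^ m) by (apply pow_lt; lra).
    assert (Hb : 0 < IZR q * (b ^ m * b ^ 18))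
      by (apply Rmult_lt_0_compat; [exact Hq | apply Rmult_lt_0_compat;
        [exact Hbm | apply pow_lt; lra]]).
    (* This factor clears every denominator. The left side only had [v^15] below, so [v^(m + 3)]
       survives there. *)
    apply Rmult_lt_reg_r with (IZR q * (b ^ m * b ^ 18)); [exact Hb |].
    replace (1 + a / b) with ((b + a) * / b) by (field; lra).
    replace (1 - a / b) with ((b - a) * / b) by (field; lra).
    unfold Rdiv. rewrite !Rpow_mult_distr, !pow_inv.
    rewrite pow_add in H.
    replace ((b + a) ^ 15 * / b ^ 15 * (IZR q * (b ^ m * b ^ 18)))
      with (IZR q * (b + a) ^ 15 * (b ^ m * b ^ 3)).
    2:{ replace (b ^ 18) with (b ^ 15 * b ^ 3) by ring.
        assert (0 < b ^ 15) by (apply pow_lt; lra). field. lra. }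
    replace (IZR p * / IZR q * IZR N ^ 18 *
       (a ^ m * / b ^ m * ((b - a) ^ 18 * / b ^ 18)) * (IZR q * (b ^ m * b ^ 18)))
      with (IZR p * IZR N ^ 18 * a ^ m * (b - a) ^ 18); [exact H |].
    assert (0 < b ^ 18) by (apply pow_lt; lra).
    field. lra.
Qed.

(* Tests [r = (n - d) / (n + 30)].  At [n = 3] only radii close to this one are
   good enough: the coefficient bounds then hold with a margin below 0.2%. *)
Definition radius_test (p q : Z) (d n : nat) : bool :=
  let m := (n - d)%nat in
  let u := Z.of_nat m in let v := (Z.of_nat n + 30)%Z in
  (q * (v + u) ^ 15 * v ^ Z.of_nat (m + 3)
     <? p * Z.of_nat n ^ 18 * u ^ Z.of_nat m * (v - u) ^ 18)%Z.

Lemma small_radius (p q : Z) (d n : nat) :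
  (0 < q)%Z -> (1 <= d <= 2)%nat -> (3 <= n < 40)%nat ->
  forallb (radius_test p q d) (seq 3 37) = true ->
  exists r, 0 < r < 1 /\
    (1 + r) ^ 15 < IZR p / IZR q * INR n ^ 18 * (r ^ (n - d) * (1 - r) ^ 18).
Proof.
  intros Hq Hd Hn H.
  rewrite INR_IZR_INZ.
  apply rational_radius with (Z.of_nat (n - d)) (Z.of_nat n + 30)%Z; [exact Hq | lia |].
  apply Z.ltb_lt.
  apply (proj1 (forallb_forall _ _) H n). apply in_seq. lia.
Qed.

Lemma exp_pow_INR (x : R) (n : nat) : exp x ^ n = exp (INR n * x).
Proof.
  induction n as [| n IH].
  - simpl. rewrite Rmult_0_l, exp_0. reflexivity.
  - rewrite <- tech_pow_Rmult, IH, <- exp_plus, S_INR. f_equal. ring.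
Qed.

(* At [r = m / (m + 18)], where [r ^ m * (1 - r) ^ 18] is maximal, this quantity
   exceeds [(18 / (e * (m + 18))) ^ 18]. *)
Lemma large_radius (p : R) (m n : nat) :
  232 / 10 ^ 9 <= p -> (1 <= m < n)%nat -> (40 <= n)%nat ->
  exists r, 0 < r < 1 /\
    (1 + r) ^ 15 < p * INR n ^ 18 * (r ^ m * (1 - r) ^ 18).
Proof.
  intros Hp Hm Hn.
  assert (Hm1 : 1 <= INR m) by (apply (le_INR 1); lia).
  assert (Hmn : INR m + 1 <= INR n) by (rewrite <- S_INR; apply le_INR; lia).
  assert (Hn40 : 40 <= INR n) by (change 40 with (IZR (Z.of_nat 40));
    rewrite <- INR_IZR_INZ; apply le_INR; lia).
  set (x := INR m) in *. set (y := INR n) in *.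
  exists (x / (x + 18)).
  assert (Hr : 0 < x / (x + 18) < 1).
  { split; [apply Rdiv_lt_0_compat; lra |].
    apply Rmult_lt_reg_r with (x + 18); [lra |].
    unfold Rdiv. rewrite Rmult_assoc, Rinv_l; lra. }
  split; [exact Hr |].
  set (r := x / (x + 18)) in *.
  (* From [(1 + 18 / m)^m <= e^18] and [e <= 3]. *)
  assert (Hexp : / 3 ^ 18 <= r ^ m).
  { assert (E : / r = 1 + 18 / x) by (unfold r; field; lra).
    assert (Hle : (/ r) ^ m <= 3 ^ 18).
    { rewrite E. apply Rle_trans with (exp (18 / x) ^ m).
      - apply pow_incr. split; [| apply exp_ineq1_le].
        assert (0 < 18 / x) by (apply Rdiv_lt_0_compat; lra). lra.
      - rewrite exp_pow_INR. fold x.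
        replace (x * (18 / x)) with (INR 18 * 1) by (simpl; field; lra).
        rewrite <- exp_pow_INR. apply pow_incr.
        split; [apply Rlt_le, exp_pos | apply exp_le_3]. }
    rewrite pow_inv in Hle. rewrite <- (Rinv_inv (r ^ m)).
    apply Rinv_le_contravar; [| exact Hle].
    apply Rinv_0_lt_compat, pow_lt. lra. }
  (* [n (1 - r) = 18 n / (m + 18) >= 18 n / (n + 17)], which increases with [n] and equals
     [240 / 19] at [n = 40]. *)
  assert (Hy : (240 / 19) ^ 18 <= y ^ 18 * (1 - r) ^ 18).
  { rewrite <- Rpow_mult_distr. apply pow_incr. split; [lra |].
    unfold r. apply Rmult_le_reg_r with (x + 18); [lra |].
    replace (y * (1 - x / (x + 18)) * (x + 18)) with (18 * y) by (field; lra). lra. }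
  assert (H15 : (1 + r) ^ 15 <= 2 ^ 15) by (apply pow_incr; lra).
  eapply Rle_lt_trans; [exact H15 |].
  replace (p * y ^ 18 * (r ^ m * (1 - r) ^ 18))
    with (p * (y ^ 18 * (1 - r) ^ 18) * r ^ m) by ring.
  (* The numerical check: [2^15 = 32768] against a value slightly above 40000. *)
  apply Rlt_le_trans with (232 / 10 ^ 9 * (240 / 19) ^ 18 * / 3 ^ 18); [lra |].
  apply Rmult_le_compat; [lra | lra | | exact Hexp].
  apply Rmult_le_compat; lra.
Qed.

(** Used with [d = 1] for [h'] and [d = 2] for [g' / z]. The factor [n] produced by differentiation
    accounts for the exponent 18 in the radius lemmas against 17 here. *)
Lemma coefficient_bound (p q : Z) (c : nat -> C) (u : C -> C) (d n : nat) (B : R) :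
  (0 < q)%Z -> 232 / 10 ^ 9 <= IZR p / IZR q -> (1 <= d <= 2)%nat -> (3 <= n)%nat ->
  forallb (radius_test p q d) (seq 3 37) = true ->
  power_series_on_disc c u ->
  (forall z, unit_disc z -> Cmod (u z) * (1 - Cmod z) ^ 18 <= (1 + Cmod z) ^ 15) ->
  Cmod (c (n - d)%nat) = INR n * B ->
  B < IZR p / IZR q * INR n ^ 17.
Proof.
  intros Hq Hp Hd Hn Htest Hu Hb HB.
  assert (Hr : exists r, 0 < r < 1 /\
    (1 + r) ^ 15 < IZR p / IZR q * INR n ^ 18 * (r ^ (n - d) * (1 - r) ^ 18)).
  { destruct (Compare_dec.le_lt_dec 40 n).
    - apply large_radius; [exact Hp | lia | assumption].
    - apply small_radius; auto. }
  destruct Hr as [r [Hr Hlt]].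
  assert (H := Cauchy_estimate_distortion c u (n - d) r Hu Hb Hr).
  rewrite HB in H.
  assert (Hpos : 0 < r ^ (n - d) * (1 - r) ^ 18)
    by (apply Rmult_lt_0_compat; apply pow_lt; lra).
  assert (Hn0 : 0 < INR n) by (apply lt_0_INR; lia).
  apply Rmult_lt_reg_l with (INR n); [exact Hn0 |].
  apply Rmult_lt_reg_r with (r ^ (n - d) * (1 - r) ^ 18); [exact Hpos |].
  replace (INR n * (IZR p / IZR q * INR n ^ 17)) with (IZR p / IZR q * INR n ^ 18)
    by ring.
  lra.
Qed.

Theorem theorem1 (f h g : C -> C) (a b : nat -> C)
  (hf : U_H0 (33 / 2) f)
  (hfhg : canonical_decomposition f h g)
  (ha : forall z : C, unit_disc z ->
     is_series (K := C_AbsRing) (V := C_NormedModule)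
       (fun k : nat => (a (k + 2)%nat * z ^ (k + 2))%C) (h z - z)%C)
  (hb : forall z : C, unit_disc z ->
     is_series (K := C_AbsRing) (V := C_NormedModule)
       (fun k : nat => Cconj (b (k + 2)%nat * z ^ (k + 2))%C) (Cconj (g z))) :
  forall n : nat, (3 <= n)%nat ->
    Cmod (a n) < (524 / 100) / 10 ^ 6 * INR n ^ 17 /\
    Cmod (b n) < (232 / 100) / 10 ^ 7 * INR n ^ 17.
Proof.
  (* The given series start at index 2 and leave [a] and [b] arbitrary below it; the normalization
     fills in the first two coefficients. *)
  set (ch := fun k => match k with O => RtoC 0 | 1%nat => RtoC 1 | _ => a k end).
  set (cg := fun k => match k with O => RtoC 0 | 1%nat => RtoC 0 | _ => b k end).
  assert (Hh : power_series_on_disc ch h).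
  { intros z Hz.
    do 2 apply (is_series_decr_1 (K := C_AbsRing) (V := C_NormedModule)).
    apply (is_series_ext (K := C_AbsRing) (V := C_NormedModule))
      with (fun k => a (k + 2)%nat * z ^ (k + 2))%C.
    - intros k. rewrite (Nat.add_comm k 2). reflexivity.
    - eapply is_Cseries_eq; [apply ha, Hz |]. ring_C. }
  assert (Hg : power_series_on_disc cg g).
  { intros z Hz.
    do 2 apply (is_series_decr_1 (K := C_AbsRing) (V := C_NormedModule)).
    apply (is_series_ext (K := C_AbsRing) (V := C_NormedModule))
      (* The hypothesis is about the conjugated series of [Cconj (g z)]; conjugating once more
         recovers that of [g]. *)
      with (fun k => Cconj (Cconj (b (k + 2)%nat * z ^ (k + 2))))%C.
    - intros k. rewrite (Nat.add_comm k 2). apply Cconj_conj.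
    - eapply is_Cseries_eq; [apply is_Cseries_conj, hb, Hz |].
      rewrite Cconj_conj. ring_C. }
  destruct (C_derive_distortion f h g ch cg (proj1 hf) hfhg Hh Hg eq_refl eq_refl)
    as [k [Hk Hbd]].
  intros n Hn.
  assert (En : exists j, n = S (S j)) by (exists (n - 2)%nat; lia).
  destruct En as [j Ej].
  split.
  - replace (524 / 100 / 10 ^ 6) with (524 / IZR (10 ^ 8)) by (simpl; lra).
    apply (coefficient_bound 524 (10 ^ 8) (derived_coef ch) (C_derive h) 1);
      [lia | simpl; lra | lia | exact Hn | vm_compute; reflexivity | | |].
    + apply power_series_C_derive, Hh.
    + intros z Hz. apply Hbd, Hz.
    + subst n. replace (S (S j) - 1)%nat with (S j) by lia.
      unfold derived_coef. rewrite Cmod_mult, Cmod_R, Rabs_pos_eq by apply pos_INR.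
      reflexivity.
  - replace (232 / 100 / 10 ^ 7) with (232 / IZR (10 ^ 9)) by (simpl; lra).
    apply (coefficient_bound 232 (10 ^ 9) (fun i => derived_coef cg (S i)) k 2);
      [lia | simpl; lra | lia | exact Hn | vm_compute; reflexivity | exact Hk | |].
    + intros z Hz. apply Hbd, Hz.
    + subst n. replace (S (S j) - 2)%nat with j by lia.
      unfold derived_coef. rewrite Cmod_mult, Cmod_R, Rabs_pos_eq by apply pos_INR.
      reflexivity.
Qed.
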